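(* Let $b$ be a positive integer and let $S,T$ be ordered trees. There exists an ordered tree $U$ such that for each coloring with $b$ colors of all rigid surjections from $U$ to $S$ there is a rigid surjection $g_0\colon U\to T$ such that the set \[ \{ f\circ g_0\mid f\colon T\to S \text{ a rigid surjection}\} \] is monochromatic.
   Context: A tree is a finite, non-empty partially ordered set $(T,\sqsubseteq_T)$ with a smallest element (the root) such that the set of predecessors of each element is linearly ordered; each node counts as its own predecessor and successor. For $v,w\in T$, $v\wedge_T w$ is the $\sqsubseteq_T$-largest common predecessor of $v$ and $w$. For $v\in T$, ${\rm im}_T(v)$ is the set of immediate successors of $v$. A tree is ordered if each ${\rm im}(v)$ carries a fixed linear order; this induces the lexicographic linear order $\leq_T$ on $T$: $v\leq_T w$ if $v\sqsubseteq_T w$, and if $v,w$ are $\sqsubseteq_T$-incomparable, $v\leq_T w$ iff the predecessor of $v$ in ${\rm im}(v\wedge_T w)$ is below or equal to the predecessor of $w$ in ${\rm im}(v\wedge_T w)$ in the given order. A morphism $e\colon S\to T$ of ordered trees is a function with $e(v\wedge_S w)=e(v)\wedge_T e(w)$ for all $v,w$, with $v\leq_S w\Rightarrow e(v)\leq_T e(w)$, and mapping the root of $S$ to the root of $T$. A function $f\colon T\to S$ between ordered trees is a rigid surjection if there is a morphism $e\colon S\to T$ with $f\circ e={\rm id}_S$ and $e(f(w))\sqsubseteq_T w$ for all $w\in T$. *)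

(* Defs.v *)
From mathcomp Require Import all_boot.
Set Implicit Arguments. Unset Strict Implicit. Unset Printing Implicit Defensive.

Section TreeNotions.
Variables (T : finType) (tle : rel T).

Definition is_root (r : T) : Prop := forall v, tle r v.

Definition is_imm (v w : T) : Prop :=
  tle v w /\ v <> w /\ forall u, tle v u -> tle u w -> u = v \/ u = w.

Definition is_meet (m v w : T) : Prop :=
  tle m v /\ tle m w /\ forall u, tle u v -> tle u w -> tle u m.

End TreeNotions.

Record OrderedTree := {
  ot_car :> finType;
  tle : rel ot_car;
  sib : rel ot_car;
  tle_refl : forall x, tle x x;
  tle_anti : forall x y, tle x y -> tle y x -> x = y;
  tle_trans : forall x y z, tle x y -> tle y z -> tle x z;
  tle_root : exists r, is_root tle r;
  tle_pred_lin : forall u v w, tle u w -> tle v w -> tle u v \/ tle v u;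
  sib_refl : forall v x, is_imm tle v x -> sib x x;
  sib_anti : forall v x y, is_imm tle v x -> is_imm tle v y ->
               sib x y -> sib y x -> x = y;
  sib_trans : forall v x y z, is_imm tle v x -> is_imm tle v y -> is_imm tle v z ->
               sib x y -> sib y z -> sib x z;
  sib_total : forall v x y, is_imm tle v x -> is_imm tle v y -> sib x y \/ sib y x
}.

Definition lexle (T : OrderedTree) (v w : T) : Prop :=
  tle v w \/
  (~ tle v w /\ ~ tle w v /\
   exists m a b, is_meet (tle (o:=T)) m v w /\ is_imm (tle (o:=T)) m a /\
     is_imm (tle (o:=T)) m b /\ tle a v /\ tle b w /\ sib a b).

Definition tree_morphism (S T : OrderedTree) (e : S -> T) : Prop :=
  (forall v w m, is_meet (tle (o:=S)) m v w -> is_meet (tle (o:=T)) (e m) (e v) (e w)) /\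
  (forall v w, lexle v w -> lexle (e v) (e w)) /\
  (forall r, is_root (tle (o:=S)) r -> is_root (tle (o:=T)) (e r)).

Definition rigid_surj (T S : OrderedTree) (f : {ffun T -> S}) : Prop :=
  exists e : S -> T, tree_morphism e /\ (forall s, f (e s) = s) /\
    (forall w, tle (e (f w)) w).

(* Main.v *)
Require Import Defs.
From Stdlib Require Import ClassicalEpsilon.
From mathcomp Require Import all_boot.
Set Implicit Arguments. Unset Strict Implicit. Unset Printing Implicit Defensive.

(* Removing the root, an ordered tree becomes a forest, and a rigid surjection
   becomes a labelling ("word") of the source by the nodes of the target together
   with constant letters, which stand for the
   nodes of the target already reached on the way from the root. The theorem
   is proved for forests and an arbitrary alphabet of constants by induction on
   S, as in the Graham-Rothschild theorem. For empty S it is a Hales-Jewett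
   theorem for trees. If x is the first root of S, let x be sent to a node v of
   the source; on the subtree of v and on the later trees the word is a rigid
   surjection onto a smaller forest (with x as a new constant), so by induction
   the colour can be made to depend only on v and on the labels of the
   predecessors of v. This remaining dependence is removed in two steps: a
   sufficiently branching tree contains one in which the colour depends only on
   the level of v and the labels below it, and a Carlson-Simpson type theorem
   for words of bounded length handles the levels. *)

(** * Labelled forests and rigid surjections between them *)

(** A relabelling [f] of the target acts on a word [g] as [fmap f g], so composing rigid surjections
    becomes substitution of labels. The property [arrow] is relative to an arbitrary relation on
    relabellings, because the intermediate results give constancy only on classes, such as that of
    equal paths to the first root, and these are joined later by unions and products. Several
    colourings are treated at once by colouring with a finite power of the colour set, whence the
    enumerations of functions and words over finite alphabets. In the last step a node of the target
    sits only where a new variable of the Carlson-Simpson word is read: its label is then still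
    free, while the colour attached to that place is already fixed by the level. Using only levels
    of one colour, and filling the other variables with a constant, gives all positions of the first
    root the same colour. Nodes that carry no part of the target need a constant letter; the removed
    root supplies it, so the alphabet starts as [[:: 0]]. *)

Inductive forest (L : Type) := Leaf | Node of L & forest L & forest L.
Arguments Leaf {L}.

Fixpoint fmap (L M : Type) (f : L -> M) (t : forest L) : forest M :=
  if t is Node x c r then Node (f x) (fmap f c) (fmap f r) else Leaf.

Fixpoint labels (L : Type) (t : forest L) : seq L :=
  if t is Node x c r then x :: labels c ++ labels r else [::].

Definition skel (L : Type) : forest L -> forest unit := fmap (fun=> tt).

Lemma fmap_comp (L M K : Type) (f : M -> K) (g : L -> M) t :
  fmap f (fmap g t) = fmap (f \o g) t.
Proof. by elim: t => //= x c -> r ->. Qed.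

Lemma skel_fmap (L M : Type) (f : L -> M) t : skel (fmap f t) = skel t.
Proof. by rewrite /skel fmap_comp. Qed.

Lemma skel_node (L : Type) (x : L) c r :
  skel (Node x c r) = Node tt (skel c) (skel r).
Proof. by []. Qed.

Lemma labels_fmap (L M : Type) (f : L -> M) t :
  labels (fmap f t) = map f (labels t).
Proof. by elim: t => //= x c -> r ->; rewrite map_cat. Qed.

Lemma fmap_id_in (L : eqType) (f : L -> L) t :
  {in labels t, f =1 id} -> fmap f t = t.
Proof.
elim: t => //= x c IHc r IHr fE; rewrite fE ?mem_head // IHc ?IHr //.
  by move=> i ir; rewrite fE // inE mem_cat ir !orbT.
by move=> i ic; rewrite fE // inE mem_cat ic orbT.
Qed.

Lemma eq_in_fmap (L : eqType) (M : Type) (f f' : L -> M) t :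
  {in labels t, f =1 f'} -> fmap f t = fmap f' t.
Proof.
elim: t => //= x c IHc r IHr fE; rewrite fE ?mem_head // IHc ?IHr //.
  by move=> i ir; rewrite fE // inE mem_cat ir !orbT.
by move=> i ic; rewrite fE // inE mem_cat ic orbT.
Qed.

Lemma fmap_eq_in (L : eqType) (M : Type) (f f' : L -> M) t :
  fmap f t = fmap f' t -> {in labels t, f =1 f'}.
Proof.
elim: t => //= x c IHc r IHr [fx /IHc Hc /IHr Hr] i.
by rewrite inE mem_cat => /or3P [/eqP -> | /Hc | /Hr].
Qed.

Notation word := (forest nat).

(* [Hom A s w]: the labelled forest w is a rigid surjection from its own shape
   onto the forest s named by its labels, except that the letters of A may be
   used everywhere. The three clauses say where the first root x of s goes: to
   the first root of w, strictly above it, or to a later tree of w. *)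
Fixpoint Hom (A : seq nat) (s w : word) {struct w} : Prop :=
  match s with
  | Leaf => {subset labels w <= A}
  | Node x cs rs =>
    if w is Node a wc wr then
      [\/ [/\ a = x, Hom (x :: A) cs wc & Hom A rs wr],
          [/\ a \in A, Hom A (Node x cs Leaf) wc & Hom A rs wr] |
          [/\ a \in A, {subset labels wc <= A} & Hom A (Node x cs rs) wr]]
    else False
  end.

Lemma Hom0 A w : Hom A Leaf w <-> {subset labels w <= A}.
Proof. by case: w. Qed.

Lemma sub_labels_node (A : seq nat) a c r :
  {subset labels (Node a c r) <= A} <->
  [/\ a \in A, {subset labels c <= A} & {subset labels r <= A}].
Proof.
split=> [sA | [aA cA rA] i] /=.
  split; [apply: sA | move=> i ic; apply: sA | move=> i ir; apply: sA];
    by rewrite inE ?eqxx // mem_cat ?ic ?ir ?orbT.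
by rewrite inE mem_cat => /or3P [/eqP -> | /cA | /rA].
Qed.

Lemma Hom_mono A A' s w : {subset A <= A'} -> Hom A s w -> Hom A' s w.
Proof.
elim: w A A' s => [|a c IHc r IHr] A A' [|x cs rs] sA //=.
  by move=> wA i /wA /sA.
have sA' : {subset x :: A <= x :: A'}.
  by move=> i; rewrite !inE => /orP [-> // | /sA ->]; rewrite orbT.
case=> [[-> Hc Hr] | [aA Hc Hr] | [aA Hc Hr]].
- by apply: Or31; split=> //; [exact: IHc Hc | exact: IHr Hr].
- by apply: Or32; split; [exact: sA | exact: IHc Hc | exact: IHr Hr].
- by apply: Or33; split; [exact: sA | move=> i /Hc /sA | exact: IHr Hr].
Qed.

Lemma Hom_labels A s w : Hom A s w -> {subset labels w <= A ++ labels s}.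
Proof.
elim: w A s => [|a c IHc r IHr] A [|x cs rs] // H i.
  by rewrite cats0; apply: H.
rewrite /= inE !(mem_cat, inE).
case: H => [[-> /IHc Hc /IHr Hr] | [aA /IHc Hc /IHr Hr] | [aA Hc /IHr Hr]];
  case/or3P=> [/eqP -> | /Hc | /Hr]; rewrite ?eqxx ?aA ?orbT //;
  rewrite ?(mem_cat, inE) /= => H; apply/orP; move: H;
  do ?[case/orP]; move=> H; rewrite ?H ?orbT; auto.
Qed.

Lemma Hom_id A t : Hom A t t.
Proof. by elim: t A => [|x c IHc r IHr] A //=; apply: Or31. Qed.

Lemma Hom_right A s a wc wr :
  a \in A -> {subset labels wc <= A} -> Hom A s wr -> Hom A s (Node a wc wr).
Proof.
case: s => [|x cs rs] aA cA H; last exact: Or33.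
by apply/Hom0/sub_labels_node; split=> //; apply/Hom0.
Qed.

(** Roots of different trees have no meet in the forest, and a section preserves meets; so the first
    tree of the source can receive at most one tree of the target, and by the order this is the
    first one. *)
Lemma Hom_split A x cs rs a wc wr :
  Hom A (Node x cs rs) (Node a wc wr) <->
  (Hom A (Node x cs Leaf) (Node a wc Leaf) /\ Hom A rs wr) \/
  (Hom A Leaf (Node a wc Leaf) /\ Hom A (Node x cs rs) wr).
Proof.
have nilA : Hom A Leaf Leaf by move=> i.
split=> [[[-> Hc Hr] | [aA Hc Hr] | [aA Hc Hr]] | [[H Hr] | [H Hr]]].
- by left; split=> //; apply: Or31.
- by left; split=> //; apply: Or32.
- by right; split=> //; apply/sub_labels_node; split.
- case: H => [[-> Hc _] | [aA Hc _] | [_ _ []]]; first exact: Or31.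
  exact: Or32.
- by case/sub_labels_node: H => aA cA _; apply: Or33.
Qed.

(** Composition. Above a node labelled [y] the letter [y] is a constant, and its image is available
    there: [f y] is either in [A'] or the root [x], which has then become a constant too. *)
Lemma Hom_comp (A A' : seq nat) s t g (f : nat -> nat) :
  Hom A t g -> {in A, forall a, f a \in A'} ->
  Hom A' s (fmap f t) -> Hom A' s (fmap f g).
Proof.
elim: g A A' s t => [|a gc IHc gr IHr] A A' s [|y tc tr] //.
  case: s => [|//] gA fA _; apply/Hom0 => i.
  by rewrite labels_fmap => /mapP [j /gA /fA ? ->].
move=> H fA Hs; case: H => [[-> Hc Hr] | [aA Hc Hr] | [aA Hc Hr]] /=; last first.
- apply: Hom_right; first exact: fA.
    by move=> i; rewrite labels_fmap => /mapP [j /Hc /fA ? ->].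
  exact: (IHr _ _ _ _ Hr).
- case: s Hs => [|x cs rs].
    case/sub_labels_node=> yA' cA' rA'; apply/sub_labels_node; split; first exact: fA.
      apply/Hom0; apply: (IHc _ _ _ _ Hc fA).
      by apply/Hom0/sub_labels_node; split.
    by apply/Hom0; apply: (IHr _ _ _ _ Hr fA); apply/Hom0.
  case/Hom_split=> [[H1 H2] | [H1 H2]].
    apply: Or32; split; [exact: fA | exact: (IHc _ _ _ _ Hc fA) |].
    exact: (IHr _ _ _ _ Hr fA).
  apply: Or33; split; [exact: fA | | exact: (IHr _ _ _ _ Hr fA)].
  by apply/Hom0; apply: (IHc _ _ _ _ Hc fA).
have fyA (B : seq nat) : f y \in B -> {subset A' <= B} -> {in y :: A, forall b, f b \in B}.
  by move=> fy sB b; rewrite inE => /orP [/eqP -> // | /fA /sB].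
case: s Hs => [|x cs rs].
  case/sub_labels_node=> yA' cA' rA'; apply/sub_labels_node; split=> //.
    by apply/Hom0; apply: (IHc _ _ _ _ Hc (fyA _ _ _)) => //; apply/Hom0.
  by apply/Hom0; apply: (IHr _ _ _ _ Hr fA); apply/Hom0.
case=> [[fy H1 H2] | [fy H1 H2] | [fy H1 H2]].
- apply: Or31; split=> //; last exact: (IHr _ _ _ _ Hr fA).
  apply: (IHc _ _ _ _ Hc (fyA _ _ _)) => //; first by rewrite fy mem_head.
  by move=> i iA; rewrite inE iA orbT.
- apply: Or32; split=> //; last exact: (IHr _ _ _ _ Hr fA).
  exact: (IHc _ _ _ _ Hc (fyA _ _ _)).
- apply: Or33; split=> //; last exact: (IHr _ _ _ _ Hr fA).
  by apply/Hom0; apply: (IHc _ _ _ _ Hc (fyA _ _ _)) => //; apply/Hom0.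
Qed.

(** When the labels of [t] are distinct, this is the relabelling that turns [t] into a word [g] of
    the same shape, extended by [f] to the other letters. *)
Fixpoint subst (t g : word) (f : nat -> nat) (i : nat) : nat :=
  match t, g with
  | Node y tc tr, Node a gc gr =>
    if i == y then a else if i \in labels tc then subst tc gc f i else subst tr gr f i
  | _, _ => f i
  end.

Lemma subst_out t g f i : i \notin labels t -> subst t g f i = f i.
Proof.
elim: t g => [|y tc IHc tr IHr] [|a gc gr] //=.
by rewrite inE mem_cat !negb_or => /and3P [/negbTE -> ic ir]; rewrite (negbTE ic) IHr.
Qed.

Lemma subst_in t g f : uniq (labels t) -> skel g = skel t ->
  fmap (subst t g f) t = g.
Proof.
elim: t g => [|y tc IHc tr IHr] [|a gc gr] //=.
rewrite mem_cat negb_or cat_uniq => /andP [/andP [yc yr] /and3P [uc dcr ur]].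
case=> /(IHc _ uc) Ec /(IHr _ ur) Er; rewrite eqxx; congr Node.
  rewrite -[RHS]Ec; apply: eq_in_fmap => i ic; rewrite ic ifN //.
  by apply: contraNneq yc => <-.
rewrite -[RHS]Er; apply: eq_in_fmap => i ir; rewrite !ifN //.
  by apply: contraNN dcr => ic; apply/hasP; exists i.
by apply: contraNneq yr => <-.
Qed.

Lemma fresh_forest k u : exists t : word,
  [/\ skel t = u, uniq (labels t) & {in labels t, forall i, k <= i}].
Proof.
(* The upper bound [k'] lets the children and the later trees take their names from disjoint
   intervals. *)
suff [t [k' [H1 H2 H3 _]]] : exists t k', [/\ skel t = u, uniq (labels t),
    {in labels t, forall i, k <= i < k'} & k <= k'].
  by exists t; split=> // i /H3 /andP [].
elim: u k => [|[] c IHc r IHr] k; first by exists Leaf, k.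
have [tc [k1 [Sc Uc Bc k1k]]] := IHc k.+1; have [tr [k2 [Sr Ur Br k21]]] := IHr k1.
exists (Node k tc tr), k2; split=> /=; first by rewrite -Sc -Sr.
- rewrite mem_cat cat_uniq Uc Ur andbT negb_or -!andbA; apply/and3P; split.
  + by apply/negP => /Bc; rewrite ltnn.
  + by apply/negP => /Br /andP [k1k' _]; have := leq_trans k1k k1k'; rewrite ltnn.
  + by apply/hasPn => i /Br /andP [i1 _]; apply/negP => /Bc /andP [_]; rewrite ltnNge i1.
- move=> i; rewrite inE mem_cat => /or3P [/eqP -> | /Bc /andP [i1 i2] | /Br /andP [i1 i2]].
  + by rewrite leqnn (leq_trans k1k).
  + by rewrite ltnW //= (leq_trans i2).
  + by rewrite i2 (leq_trans _ i1) // ltnW.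
- by rewrite (leq_trans _ k21) // ltnW.
Qed.

Lemma seq_bound (A : seq nat) : exists k, {in A, forall a, a < k}.
Proof.
elim: A => [|a A [k Hk]]; first by exists 0.
exists (maxn a.+1 k) => i; rewrite inE leq_max => /orP [/eqP -> | /Hk ->].
  by rewrite leqnn.
by rewrite orbT.
Qed.

Lemma finite_functions (D B : seq nat) : exists n (F : 'I_n -> nat -> nat),
  forall f : nat -> nat, {in D, forall d, f d \in B} -> exists i, {in D, F i =1 f}.
Proof.
elim: D => [|d D [n [F HF]]]; first by exists 1, (fun _ => id) => f _; exists ord0.
exists #|{: 'I_n * 'I_(size B)}|, (fun i x =>
  let p : 'I_n * 'I_(size B) := enum_val i in
  if x == d then nth 0 B p.2 else F p.1 x).
move=> f fB; case: (HF f) => [e eD | i iE].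
  by apply: fB; rewrite inE eD orbT.
have fdB : index (f d) B < size B by rewrite index_mem fB ?mem_head.
exists (enum_rank (i, Ordinal fdB)) => e.
rewrite /= enum_rankK /= inE; case: eqP => [-> _ | _ /iE //].
by rewrite nth_index // fB ?mem_head.
Qed.

Lemma finite_words (u : forest unit) (B : seq nat) : exists n (F : 'I_n -> word),
  forall w, skel w = u -> {subset labels w <= B} -> exists i, F i = w.
Proof.
elim: u => [|[] c [nc [Fc Hc]] r [nr [Fr Hr]]].
  by exists 1, (fun _ => Leaf) => -[] // _ _; exists ord0.
exists #|{: 'I_(size B) * 'I_nc * 'I_nr}|, (fun i =>
  let p : 'I_(size B) * 'I_nc * 'I_nr := enum_val i in
  Node (nth 0 B p.1.1) (Fc p.1.2) (Fr p.2)).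
case=> [|a wc wr] //= [/Hc {}Hc /Hr {}Hr] /sub_labels_node [aB /Hc [i <-] /Hr [j <-]].
rewrite -index_mem in aB; exists (enum_rank (Ordinal aB, i, j)).
by rewrite enum_rankK /= nth_index // -index_mem.
Qed.

(** * Ramsey statements *)

Definition fnrel := (nat -> nat) -> (nat -> nat) -> Prop.

(* Ramsey statement for the target t: every finite colouring of the words of
   some shape u can be pulled back along a rigid surjection g from u to t so as
   to become constant on the classes of E. *)
Definition arrow (A : seq nat) (t : word) (E : fnrel) : Prop :=
  forall C : finType, exists u, forall c : word -> C, exists g,
    [/\ skel g = u, Hom A t g &
        forall f f', E f f' -> c (fmap f g) = c (fmap f' g)].

Definition hrel (A : seq nat) (s t : word) : fnrel := fun f f' =>
  [/\ {in A, f =1 id}, {in A, f' =1 id}, Hom A s (fmap f t) & Hom A s (fmap f' t)].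

Lemma arrow_weak A A' t (E E' : fnrel) : {subset A <= A'} ->
  (forall f f', E' f f' -> E f f') -> arrow A t E -> arrow A' t E'.
Proof.
move=> sA sE H C; have [u Hu] := H C; exists u => c.
have [g [Sg Hg cg]] := Hu c; exists g; split=> //; first exact: Hom_mono Hg.
by move=> f f' /sE /cg.
Qed.

Lemma arrow_nil A E : arrow A Leaf E.
Proof. by move=> C; exists Leaf => c; exists Leaf; split. Qed.

(* Refine for E2 on a freshly named target t1, then for E1 on t itself. *)
Lemma arrow_union (A B : seq nat) k t (E1 E2 : fnrel) (E2' : word -> fnrel) :
  {in A, forall a, a < k} ->
  (forall f f', E1 f f' -> {in A, forall a, f a = f' a /\ f a \in B}) ->
  (forall t1 f f' (s : nat -> nat), {in A, s =1 id} -> Hom A t (fmap s t1) -> E2 f f' ->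
     E2' t1 (f \o s) (f' \o s)) ->
  arrow A t E1 ->
  (forall t1, {in labels t1, forall i, k <= i} -> arrow A t1 (E2' t1)) ->
  arrow A t (fun f f' => E1 f f' \/ E2 f f').
Proof.
move=> Ak E1A E2p H1 H2 C.
have [n [F HF]] := finite_functions A B.
have [u1 Hu1] := H1 {ffun 'I_n -> C}.
have [t1 [St1 Ut1 Bt1]] := fresh_forest k u1.
have [u Hu] := H2 _ Bt1 C; exists u => c.
have [g1 [Sg1 Hg1 cg1]] := Hu c.
(* Under [E1] the maps [f] and [f'] agree on the constants without having to fix them, so the
   colouring records one colour for each way [F i] of sending [A] to [B]. *)
have [g2 [Sg2 Hg2 cg2]] :=
  Hu1 (fun h => [ffun i => c (fmap (subst t1 h (F i)) g1)]).
pose s := subst t1 g2 id.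
have outA i : i \in A -> i \notin labels t1.
  by move=> /Ak ik; apply/negP => /Bt1; rewrite leqNgt ik.
have sA : {in A, s =1 id} by move=> i /outA i1; rewrite /s subst_out.
have st1 : fmap s t1 = g2 by rewrite subst_in // Sg2.
have Hst1 : Hom A t (fmap s t1) by rewrite st1.
exists (fmap s g1); split; first by rewrite skel_fmap.
  by apply: (Hom_comp Hg1) => // i iA; rewrite sA.
move=> f f' []; last first.
  by move=> /(E2p _ _ _ _ sA Hst1) /cg1; rewrite !fmap_comp.
move=> Eff; have fA := E1A _ _ Eff.
have [i Fi] := HF f (fun a aA => (fA a aA).2).
have step h : {in A, h =1 f} ->
    fmap h (fmap s g1) = fmap (subst t1 (fmap h g2) (F i)) g1.
  move=> hA; rewrite fmap_comp; apply: eq_in_fmap => j /(Hom_labels Hg1).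
  rewrite mem_cat => /orP [jA | ].
    by rewrite /= subst_out ?outA // sA // Fi // hA.
  apply: fmap_eq_in; rewrite subst_in ?skel_fmap ?Sg2 //.
  by rewrite -st1 fmap_comp.
have /ffunP /(_ i) := cg2 _ _ Eff; rewrite !ffunE.
by rewrite -!step // => j /fA [].
Qed.

Definition into (A B : seq nat) (t : word) (f : nat -> nat) : Prop :=
  {in A ++ labels t, forall i, f i \in B}.

Lemma into_word A B t g f : Hom A t g -> into A B t f ->
  {subset labels (fmap f g) <= B}.
Proof. by move=> /Hom_labels H fB i; rewrite labels_fmap => /mapP [j /H /fB ? ->]. Qed.

(** Product argument: [g'] is chosen for all words of shape [u] over [B] at once, then [g] for all
    relabellings of [g'] at once. The second factor is exchanged first, under [f1], and then the
    first one, under [f2']; hence the two [into] conditions. *)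
Lemma arrow_pair A A' B t t' (E E' : fnrel) : arrow A t E -> arrow A' t' E' ->
  forall C : finType, exists u u', forall c : word -> word -> C, exists g g',
    [/\ skel g = u, skel g' = u', Hom A t g, Hom A' t' g' &
      forall f1 f2 f1' f2', E f1 f2 -> E' f1' f2' -> into A B t f1 ->
        into A' B t' f2' ->
        c (fmap f1 g) (fmap f1' g') = c (fmap f2 g) (fmap f2' g')].
Proof.
move=> H H' C.
have [n [F HF]] := finite_functions (A' ++ labels t') B.
have [u Hu] := H {ffun 'I_n -> C}.
have [n' [F' HF']] := finite_words u B.
have [u' Hu'] := H' {ffun 'I_n' -> C}.
exists u, u' => c.
have [g' [Sg' Hg' cg']] := Hu' (fun w => [ffun i => c (F' i) w]).
have [g [Sg Hg cg]] := Hu (fun w => [ffun i => c w (fmap (F i) g')]).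
exists g, g'; split=> // f1 f2 f1' f2' E12 E12' f1B f2B.
have [i Fi] : exists i, F' i = fmap f1 g.
  by apply: HF'; [rewrite skel_fmap | exact: into_word f1B].
have /ffunP /(_ i) := cg' _ _ E12'; rewrite !ffunE Fi => ->.
have [j Fj] := HF _ f2B.
have -> : fmap f2' g' = fmap (F j) g'.
  by apply: eq_in_fmap => k /(Hom_labels Hg') /Fj.
by have /ffunP /(_ j) := cg _ _ E12; rewrite !ffunE.
Qed.

(* The trees of the target are placed strictly inside the trees of g, below a
   root carrying a constant letter a0, so that no information about the label
   of the root y reaches its right siblings. *)
Lemma arrow_cons (A B : seq nat) a0 y tc tr (E Ec Er : fnrel) : a0 \in A ->
  (forall f f', E f f' -> [/\ Ec f f', Er f f', f a0 = a0 & f' a0 = a0]) ->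
  (forall f f', E f f' -> into A B (Node y tc tr) f /\ into A B (Node y tc tr) f') ->
  arrow A (Node y tc Leaf) Ec -> arrow A tr Er ->
  arrow A (Node y tc tr) E.
Proof.
move=> a0A HE EB Hc Hr C.
have [uc [ur Hu]] := arrow_pair B Hc Hr C.
exists (Node tt uc ur) => c.
have [gc [gr [Sc Sr Hgc Hgr cg]]] := Hu (fun w w' => c (Node a0 w w')).
exists (Node a0 gc gr); split=> [||f f' Eff].
- by rewrite -Sc -Sr.
- exact: Or32.
have [Ecf Erf f0 f0'] := HE _ _ Eff; have [fB fB'] := EB _ _ Eff.
rewrite /= f0 f0'; apply: (cg _ _ _ _ Ecf Erf) => i; rewrite mem_cat => iA.
  apply: fB; move: iA; rewrite mem_cat /= cats0 !inE mem_cat.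
  by case/or3P => ->; rewrite ?orbT.
apply: fB'; move: iA; rewrite mem_cat inE mem_cat.
by case/orP => ->; rewrite ?orbT.
Qed.

Lemma hrel_into A s t f f' : hrel A s t f f' ->
  into A (A ++ labels s) t f /\ into A (A ++ labels s) t f'.
Proof.
case=> fA fA' Hf Hf'; split=> i; rewrite mem_cat => /orP [iA | it].
- by rewrite fA // mem_cat iA.
- by apply: (Hom_labels Hf); rewrite labels_fmap map_f.
- by rewrite fA' // mem_cat iA.
- by apply: (Hom_labels Hf'); rewrite labels_fmap map_f.
Qed.

Lemma hrel_pull A s t t1 f f' (h : nat -> nat) : {in A, h =1 id} -> Hom A t (fmap h t1) ->
  hrel A s t f f' -> hrel A s t1 (f \o h) (f' \o h).
Proof.
move=> hA Ht [fA fA' Hf Hf']; split.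
- by move=> i iA; rewrite /= hA // fA.
- by move=> i iA; rewrite /= hA // fA'.
- by rewrite -fmap_comp; apply: (Hom_comp Ht) => // i iA; rewrite fA.
- by rewrite -fmap_comp; apply: (Hom_comp Ht) => // i iA; rewrite fA'.
Qed.

(** * The Hales-Jewett theorem *)

Lemma finite_seqs (A : seq nat) n : exists N (F : 'I_N -> seq nat),
  forall w, size w = n -> {subset w <= A} -> exists i, F i = w.
Proof.
elim: n => [|n [N [F HF]]].
  by exists 1, (fun _ => [::]) => w /size0nil -> _; exists ord0.
exists #|{: 'I_(size A) * 'I_N}|, (fun i =>
  let p : 'I_(size A) * 'I_N := enum_val i in nth 0 A p.1 :: F p.2).
case=> [|a w] // [Sw] wA.
have [i <-] := HF w Sw (fun b bw => wA b (@mem_behead _ (a :: w) b bw)).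
have aA : a \in A by apply: wA; rewrite mem_head.
rewrite -index_mem in aA.
by exists (enum_rank (Ordinal aA, i)); rewrite enum_rankK /= nth_index // -index_mem.
Qed.

(* Variable words: a letter is a constant [inl a] or a variable [inr j]. *)
Definition eval (r : nat -> nat) : seq (nat + nat) -> seq nat :=
  map (fun l => match l with inl a => a | inr j => r j end).

Definition consts_in (A : seq nat) (g : seq (nat + nat)) : Prop :=
  forall a, inl a \in g -> a \in A.

(* Shelah's cube lemma: on the cube spanned by g the colouring does not
   distinguish the letters z and a0. *)
Lemma shelah_cube (A : seq nat) (a0 z : nat) (p := fun i => if i == z then a0 else i)
    (m : nat) (C : finType) : a0 \in A -> z \in A ->
  exists n, forall c : seq nat -> C, exists g,
    [/\ size g = n, consts_in A g, forall j, j < m -> inr j \in g,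
        forall j, inr j \in g -> j < m &
        forall r : nat -> nat, (forall j, r j \in A) ->
          c (eval r g) = c (eval (p \o r) g)].
Proof.
move=> a0A zA; elim: m C => [|m IHm] C; first by exists 0 => c; exists [::].
have [nF [F HF]] := finite_functions (iota 0 m) A.
(* A head is coloured by the colours it gives under all valuations of the other variables. There are
   [n1] such colours and [n1 + 1] heads [hd j], so two heads agree; the block where they differ
   becomes the new variable [m]. *)
pose V := {ffun 'I_nF -> C}; pose n1 := #|V|.
have [nW [W HW]] := finite_seqs A n1.
have [n' Hn'] := IHm {ffun 'I_nW -> C}.
exists (n1 + n') => c.
have [g' [Sg' g'A g'occ g'm g'c]] := Hn' (fun w => [ffun i => c (W i ++ w)]).
pose hd j := nseq j a0 ++ nseq (n1 - j) z.
pose col (j : 'I_n1.+1) : V := [ffun i => c (hd j ++ eval (F i) g')].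
have [j [j' [ltjj' ejj']]] : exists j j' : 'I_n1.+1, j < j' /\ col j = col j'.
  have /injectivePn [j1 [j2 nej ecol]] : ~~ injectiveb col.
    by apply/negP => /injectiveP /leq_card; rewrite card_ord ltnn.
  case: (ltngtP j1 j2) => [lt | gt | e]; [by exists j1, j2 | by exists j2, j1 |].
  by rewrite (val_inj e) eqxx in nej.
have j'n1 : j' <= n1 by rewrite -ltnS.
pose g : seq (nat + nat) := nseq j (inl a0) ++ nseq (j' - j) (inr m)
  ++ nseq (n1 - j') (inl z) ++ g'.
pose hdr x := nseq j a0 ++ nseq (j' - j) x ++ nseq (n1 - j') z.
have evE r : eval r g = hdr (r m) ++ eval r g'.
  by rewrite /eval /g !map_cat !map_nseq /hdr -!catA.
have hdr_sub x : x \in A -> {subset hdr x <= A}.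
  by move=> xA i; rewrite !mem_cat !mem_nseq => /or3P [] /andP [_ /eqP ->].
have hdr_size x : size (hdr x) = n1.
  by rewrite !size_cat !size_nseq addnA subnKC ?subnKC // ltnW.
have hdr_z : hdr z = hd j.
  rewrite /hdr /hd -nseqD; congr (_ ++ nseq _ _).
  by rewrite addnC addnBA 1?ltnW // subnK.
have hdr_a : hdr a0 = hd j' by rewrite /hdr /hd catA -nseqD subnKC 1?ltnW.
exists g; split.
- by rewrite !size_cat !size_nseq Sg' !addnA subnKC ?subnKC // ltnW.
- move=> a; rewrite !mem_cat !mem_nseq.
  case/or4P=> [/andP [_ /eqP [->]] | /andP [] // | /andP [_ /eqP [->]] | /g'A] //.
- move=> i; rewrite ltnS leq_eqVlt => /orP [/eqP -> | /g'occ ig'].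
    by rewrite !mem_cat !mem_nseq subn_gt0 ltjj' eqxx orbT.
  by rewrite !mem_cat ig' !orbT.
- move=> i; rewrite !mem_cat !mem_nseq.
  by case/or4P=> [/andP [] // | /andP [_ /eqP [->]] | /andP [] // | /g'm /ltnW].
move=> r rA; rewrite !evE /=.
have pA i : i \in A -> p i \in A by rewrite /p; case: eqP.
have tail x : x \in A -> c (hdr x ++ eval r g') = c (hdr x ++ eval (p \o r) g').
  move=> xA; have /ffunP := g'c r rA.
  have [i Wi] := HW _ (hdr_size x) (hdr_sub _ xA).
  by move=> /(_ i); rewrite !ffunE Wi.
rewrite /p; case: eqP => [rz | _]; last exact: tail.
rewrite rz -tail // hdr_z hdr_a.
have [i Fi] : exists i, {in iota 0 m, F i =1 r} by apply: HF.
move/ffunP: ejj' => /(_ i); rewrite !ffunE.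
suff -> : eval (F i) g' = eval r g' by [].
apply/eq_in_map => -[a | k] // /g'm km; apply: Fi.
by rewrite mem_iota.
Qed.

Definition fill (a : nat) : seq (option nat) -> seq nat := map (odflt a).

(** Shelah's induction on the alphabet: in a cube of dimension [m], the length that works for [A],
    the new letter [z] may be replaced by [a0], so a line for [A] inside the cube is also one for
    [z :: A]. *)
Lemma hales_jewett (A : seq nat) (C : finType) :
  exists n, forall c : seq nat -> C, exists v,
    [/\ size v = n, None \in v, forall a, Some a \in v -> a \in A &
        forall a b, a \in A -> b \in A -> c (fill a v) = c (fill b v)].
Proof.
have trivial_case B : (forall a b, a \in B -> b \in B -> a = b) ->
  exists n, forall c : seq nat -> C, exists v,
    [/\ size v = n, None \in v, forall a, Some a \in v -> a \in B &
        forall a b, a \in B -> b \in B -> c (fill a v) = c (fill b v)].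
  move=> B1; exists 1 => c; exists [:: None]; split=> // a b aB bB.
  by rewrite (B1 _ _ aB bB).
elim: A => [|z A IH]; first exact: trivial_case.
case zA: (z \in A).
  have [n Hn] := IH; exists n => c; have [v [Sv nv vA cv]] := Hn c.
  have sA a : a \in z :: A -> a \in A by rewrite inE => /orP [/eqP -> |].
  exists v; split=> // [a /vA aA | a b /sA aA /sA bA]; last exact: cv.
  by rewrite inE aA orbT.
case: A zA IH => [|a0 A'] zA [m Hm].
  by apply: trivial_case => a b; rewrite !inE => /eqP -> /eqP ->.
set A := a0 :: A' in zA Hm *.
have a0A : a0 \in A by rewrite mem_head.
have a0zA : a0 \in z :: A by rewrite inE a0A orbT.
have [n Hn] := @shelah_cube (z :: A) a0 z m C a0zA (mem_head _ _).
exists n => c; have [g [Sg gA gocc gm gc]] := Hn c.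
have [v' [Sv' nv' v'A cv']] := Hm (fun w => c (eval (nth a0 w) g)).
pose v := map (fun l => match l with inl a => Some a | inr j => nth None v' j end) g.
have vE a : fill a v = eval (nth a0 (fill a v')) g.
  rewrite /fill /v -map_comp; apply/eq_in_map => -[b | j] //= /gm jm.
  by rewrite (nth_map None) ?Sv'.
have nth_A a j : a \in z :: A -> nth a0 (fill a v') j \in z :: A.
  move=> aA; case: (ltnP j (size v')) => [lt | ge]; last first.
    by rewrite nth_default // size_map.
  rewrite (nth_map None) //; case E: (nth None v' j) => [b|] //=.
  by rewrite inE v'A ?orbT // -E mem_nth.
have key a : a \in z :: A -> c (fill a v) = c (fill a0 v).
  move=> aA; rewrite vE gc //; last by move=> j; exact: nth_A.
  (* The constants of [v'] lie in [A] and so differ from [z]: replacing [z] by [a0] affects only the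
     variable. *)
  have -> : eval ((fun i => if i == z then a0 else i) \o nth a0 (fill a v')) g =
            fill (if a == z then a0 else a) v.
    rewrite vE; apply/eq_in_map => -[b | j] //= /gm jm.
    rewrite !(nth_map None) ?Sv' //; case E: (nth None v' j) => [b|] //=.
    rewrite ifN //; apply: contraFneq zA => <-.
    by apply: v'A; rewrite -E mem_nth ?Sv'.
  rewrite !vE; apply: cv' => //.
  by case: eqP aA => [_ _ // | /eqP nz]; rewrite inE (negbTE nz).
exists v; split.
- by rewrite size_map.
- have jm : index None v' < m by rewrite -Sv' index_mem.
  by apply/mapP; exists (inr (index None v')); [exact: gocc | rewrite nth_index].
- move=> a /mapP [[b | j] lg e]; first by case: e => ->; exact: gA.
  rewrite inE v'A ?orbT // e mem_nth // Sv'; exact: gm.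
- by move=> a b /key -> /key ->.
Qed.

(** * The Hales-Jewett theorem for forests *)

Definition const_on (A : seq nat) (a0 i : nat) : nat := if i \in A then i else a0.

Lemma hrel_Leaf A t f f' : {in A, f =1 id} -> {in A, f' =1 id} ->
  {in labels t, forall i, f i \in A} -> {in labels t, forall i, f' i \in A} ->
  hrel A Leaf t f f'.
Proof.
move=> fA fA' Hf Hf'; split=> //; apply/Hom0 => i; rewrite labels_fmap => /mapP [j].
  by move=> /Hf ? ->.
by move=> /Hf' ? ->.
Qed.

Lemma const_on_in A a0 i : a0 \in A -> const_on A a0 i \in A.
Proof. by rewrite /const_on; case: ifP. Qed.

Lemma const_on_id A a0 : {in A, const_on A a0 =1 id}.
Proof. by rewrite /const_on => i ->. Qed.

Lemma const_word A a0 g f : a0 \in A -> {in A, f =1 id} ->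
  fmap f (fmap (const_on A a0) g) = fmap (const_on A a0) g.
Proof.
by move=> a0A fA; rewrite fmap_comp; apply: eq_in_fmap => i _; apply/fA/const_on_in.
Qed.

Lemma const_word_labels A a0 g : a0 \in A ->
  {subset labels (fmap (const_on A a0) g) <= A}.
Proof. by move=> a0A i; rewrite labels_fmap => /mapP [j _ ->]; exact: const_on_in. Qed.

(* u is a chain of n nodes, each with a copy of a forest for tc attached next to
   it, and one more copy on top. Once the colour does not depend on the letters
   used in the copies, it is a function D of the word v read along the chain.
   The root y of the target sits at the first occurrence of y in v, and its
   children in the copy attached just above. *)
Lemma spine (A : seq nat) a0 y tc n (C : finType)
    (valid := fun f => [/\ {in A, f =1 id}, f y \in A & {in labels tc, forall i, f i \in A}]) :
  a0 \in A -> arrow A tc (hrel A Leaf tc) ->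
  exists u, forall c : word -> C, exists D : seq nat -> C, forall v,
    size v = n -> {subset v <= y :: A} ->
    [/\ exists g, [/\ skel g = u, {subset labels g <= y :: A} &
          forall f, valid f -> c (fmap f g) = D (map f v)],
        exists g, [/\ skel g = u, Hom (y :: A) tc g &
          forall f, valid f -> c (fmap f g) = D (map f v)] &
        y \in v -> exists g, [/\ skel g = u, Hom A (Node y tc Leaf) g &
          forall f, valid f -> c (fmap f g) = D (map f v)]].
Proof.
move=> a0A Htc; pose k0 := const_on A a0.
have sAy : {subset A <= y :: A} by move=> i iA; rewrite inE iA orbT.
have k0_rel f : valid f -> hrel A Leaf tc f k0.
  case=> fA _ ft; apply: hrel_Leaf => //; first exact: const_on_id.
  by move=> i _; exact: const_on_in.
elim: n C => [|n IHn] C.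
  have [u Hu] := Htc C; exists u => c; have [g [Sg Hg cg]] := Hu c.
  exists (fun _ => c (fmap k0 g)) => v /size0nil -> _; split=> //.
    exists (fmap k0 g); split=> [||f [fA _ _]].
    - by rewrite skel_fmap.
    - by move=> i /(const_word_labels a0A) /sAy.
    - by rewrite const_word.
  exists g; split=> // [|f /k0_rel /cg //]; exact: Hom_mono Hg.
have [u1 Hu1] := IHn {ffun 'I_(size A) -> C}.
have [m [W HW]] := finite_words u1 A.
have [uV HuV] := Htc {ffun 'I_(size A) * 'I_m -> C}.
exists (Node tt u1 uV) => c.
(* The copy [gV] serves all root letters and all words on the rest of the chain at once. Its
   relabellings can then be replaced by [k0], which leaves a colouring of the rest of the chain. *)
have [gV [SgV HgV cgV]] := HuV (fun w => [ffun p : 'I_(size A) * 'I_m =>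
  c (Node (nth 0 A p.1) (W p.2) w)]).
have [D1 HD1] := Hu1 (fun w => [ffun i : 'I_(size A) =>
  c (Node (nth 0 A i) w (fmap k0 gV))]).
have cV f a w : valid f -> a \in A -> skel w = u1 -> {subset labels w <= A} ->
    c (Node a w (fmap f gV)) = c (Node a w (fmap k0 gV)).
  move=> vf aA Sw wA; have [j <-] := HW w Sw wA.
  have /ffunP := cgV _ _ (k0_rel f vf).
  rewrite -index_mem in aA; move=> /(_ (Ordinal aA, j)).
  by rewrite !ffunE /= nth_index // -index_mem.
pose aidx a : 'I_(size A).-1.+1 := inord (index a A).
have szA : (size A).-1.+1 = size A by case: (A) a0A.
pose D (w : seq nat) : C := if w is a :: w' then D1 w' (cast_ord szA (aidx a))
  else c Leaf.
have nth_aidx a : a \in A -> nth 0 A (cast_ord szA (aidx a)) = a.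
  by move=> aA; rewrite /= inordK ?nth_index // szA index_mem.
exists D => -[|b v] // [Sv] bvA.
have bA : b \in y :: A by apply: bvA; rewrite mem_head.
have vA : {subset v <= y :: A} by move=> i iv; apply: bvA; rewrite inE iv orbT.
have fyA f i : valid f -> i \in y :: A -> f i \in A.
  by case=> fA fy _; rewrite inE => /orP [/eqP -> // | iA]; rewrite fA.
have fwA f g : valid f -> {subset labels g <= y :: A} -> {subset labels (fmap f g) <= A}.
  by move=> vf gA i; rewrite labels_fmap => /mapP [j /gA /(fyA _ _ vf) ? ->].
have [[gW [SW HW' cW]] [gT [ST HT cT]] gY] := HD1 v Sv vA.
have colD f g : valid f -> [ffun i : 'I_(size A) =>
    c (Node (nth 0 A i) (fmap f g) (fmap k0 gV))] = D1 (map f v) ->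
    c (Node (f b) (fmap f g) (fmap k0 gV)) = D (map f (b :: v)).
  by move=> vf /= <-; rewrite ffunE nth_aidx // fyA.
have k0V f : valid f -> fmap f (fmap k0 gV) = fmap k0 gV.
  by case=> fA _ _; exact: const_word.
have SV f : skel (fmap f gV) = uV by rewrite skel_fmap.
split.
- exists (Node b gW (fmap k0 gV)); split=> [||f vf].
  + by rewrite skel_node SW SV.
  + by apply/sub_labels_node; split=> // i /(const_word_labels a0A) /sAy.
  + by rewrite /= k0V // colD // cW.
- exists (Node b gW gV); split=> [||f vf].
  + by rewrite skel_node SW SgV.
  + by apply: Hom_right => //; exact: Hom_mono HgV.
  + by rewrite /= cV ?skel_fmap ?fyA ?colD ?cW //; exact: fwA.
(* At the first [y] the target root is placed. Above it [y] is a constant and [tc] is still to be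
   covered, which is the second of the three forms. *)
case: (eqVneq b y) => [-> | nby] yv.
  exists (Node y gT (fmap k0 gV)); split=> [||f vf].
  + by rewrite skel_node ST SV.
  + by apply: Or31; split=> //; apply/Hom0/const_word_labels.
  + by rewrite /= k0V // -(cT f vf) ffunE nth_aidx //; case: vf.
have {}bA : b \in A by move: bA; rewrite inE (negbTE nby).
have {}yv : y \in v by move: yv; rewrite inE eq_sym (negbTE nby).
have [g [Sg Hg cg]] := gY yv.
exists (Node b g (fmap k0 gV)); split=> [||f vf].
+ by rewrite skel_node Sg SV.
+ by apply: Or32; split=> //; apply/Hom0/const_word_labels.
+ by rewrite /= k0V // colD // cg.
Qed.

(** For a single tree, a Hales-Jewett line for [D], with its variable named [y], is the word read
    along the chain: relabelling by [f] puts [f y] into the line. As the line contains its variable,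
    the root [y] gets a place. *)
Lemma arrow_words (A : seq nat) a0 t : a0 \in A -> arrow A t (hrel A Leaf t).
Proof.
move=> a0A; elim: t => [|y tc IHc tr IHr]; first exact: arrow_nil.
have tree : arrow A (Node y tc Leaf) (hrel A Leaf (Node y tc Leaf)).
  move=> C; have [n Hn] := hales_jewett A C.
  have [u Hu] := spine y n C a0A IHc; exists u => c.
  have [D HD] := Hu c; have [v [Sv nv vA cv]] := Hn D.
  have yv : y \in fill y v by apply/mapP; exists None.
  have sv : {subset fill y v <= y :: A}.
    by move=> i /mapP [[a /vA aA | _] -> /=]; rewrite inE ?aA ?orbT ?eqxx.
  have [_ _ /(_ yv) [g [Sg Hg cg]]] := HD _ (etrans (size_map _ _) Sv) sv.
  exists g; split=> // f f' [fA fA' Hf Hf'].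
  have validP h : {in A, h =1 id} -> Hom A Leaf (fmap h (Node y tc Leaf)) ->
      [/\ {in A, h =1 id}, h y \in A & {in labels tc, forall i, h i \in A}].
    move=> hA /Hom0 /sub_labels_node [hy ht _]; split=> // i it.
    by apply: ht; rewrite labels_fmap map_f.
  have fillE h : {in A, h =1 id} -> map h (fill y v) = fill (h y) v.
    by move=> hA; rewrite /fill -map_comp; apply/eq_in_map => -[a /vA /hA | ].
  have [vf vf'] := (validP f fA Hf, validP f' fA' Hf').
  rewrite !cg // !fillE //; apply: cv; [by case: vf | by case: vf'].
apply: (@arrow_cons A A a0 _ _ _ _ _ _ a0A _ _ tree IHr) => f f'.
  move=> [fA fA' /Hom0 /sub_labels_node [hy hc hr] /Hom0 /sub_labels_node [hy' hc' hr']].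
  split; [| | exact: fA | exact: fA']; last by split=> //; apply/Hom0.
  by split=> //; apply/Hom0/sub_labels_node; split.
by move=> /hrel_into; rewrite cats0.
Qed.

(** * Reduction to the position of the first root *)

(* The way from the first root of w to the first node labelled x: [None] is a
   step to the right sibling, [Some a] a step to the first child of a node
   labelled a. Labels of skipped siblings are not recorded. *)
Fixpoint dpath (x : nat) (w : word) : option (seq (option nat)) :=
  if w is Node a c r then
    if a == x then Some [::] else
    if dpath x c is Some p then Some (Some a :: p)
    else omap (cons None) (dpath x r)
  else None.

Lemma dpath_none (A : seq nat) x w : x \notin A -> {subset labels w <= A} ->
  dpath x w = None.
Proof.
move=> xA; elim: w => //= a c IHc r IHr /sub_labels_node [aA /IHc -> /IHr ->].
by rewrite ifN //; apply: contraNneq xA => <-.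
Qed.

Lemma dpath_some A x cs rs w : x \notin A -> Hom A (Node x cs rs) w ->
  exists p, dpath x w = Some p.
Proof.
move=> xA; elim: w rs => //= a c IHc r IHr rs.
case: eqP => [_ _ | ax]; first by exists [::].
case=> [[//] | [_ /IHc [p ->] _] | [_ cA /IHr [p ->]]]; first by exists (Some a :: p).
by rewrite (dpath_none xA cA); exists (None :: p).
Qed.

Definition prel (A : seq nat) (s : word) (x : nat) (t : word) : fnrel :=
  fun f f' => hrel A s t f f' /\ dpath x (fmap f t) = dpath x (fmap f' t).

Definition ramsey (A : seq nat) (s : word) : Prop :=
  forall t, arrow A t (hrel A s t).

Lemma arrow_union_ramsey (A B : seq nat) s t (E : fnrel) :
  (forall f f', E f f' -> {in A, forall a, f a = f' a /\ f a \in B}) ->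
  arrow A t E -> ramsey A s ->
  arrow A t (fun f f' => E f f' \/ hrel A s t f f').
Proof.
move=> EB HE Hs; have [k Ak] := seq_bound A.
apply: (@arrow_union A B k t E _ (hrel A s) Ak EB) => // t1 f f' h hA Ht.
exact: hrel_pull.
Qed.

(** Either [f y = x], and the rest is a word onto [cs] with [x] constant, or [f y] is a constant and
    [x] lies further up; the path tells which. Above the root the letter [x] stands for the label of
    [y], until [ren] turns it into [y]; in the first case it is already the right constant. So one
    word over [x :: A] serves both cases. *)
Lemma arrow_path_tree A x cs y tc : x \notin A -> x \notin labels tc ->
  ramsey (x :: A) cs ->
  arrow A tc (prel A (Node x cs Leaf) x tc) ->
  arrow A (Node y tc Leaf) (prel A (Node x cs Leaf) x (Node y tc Leaf)).
Proof.
move=> xA xt Hcs Htc.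
pose E1 : fnrel := fun h h' =>
  [/\ prel A (Node x cs Leaf) x tc h h', h x = h' x & h x \in A].
have H1 : arrow (x :: A) tc E1.
  apply: (arrow_weak _ _ Htc) => [i iA | f f' []]; last by [].
  by rewrite inE iA orbT.
have E1B h h' : E1 h h' -> {in x :: A, forall a, h a = h' a /\ h a \in A}.
  case=> [[[hA hA' _ _] _] hx hxA] a; rewrite inE => /orP [/eqP -> // | aA].
  by rewrite hA // hA'.
have H := arrow_union_ramsey E1B H1 Hcs.
move=> C; have [u Hu] := H {ffun 'I_(size (x :: A)) -> C}.
exists (Node tt u Leaf) => c.
have [g [Sg Hg cg]] := Hu (fun w => [ffun i : 'I_(size (x :: A)) =>
  c (Node (nth 0 (x :: A) i) w Leaf)]).
pose ren i := if i == x then y else i.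
have renA : {in A, ren =1 id}.
  by move=> i iA; rewrite /ren ifN //; apply: contraNneq xA => <-.
have rent : fmap ren tc = tc.
  by apply: fmap_id_in => i it; rewrite /ren ifN //; apply: contraNneq xt => <-.
exists (Node y (fmap ren g) Leaf); split.
- by rewrite skel_node skel_fmap Sg.
- apply: Or31; split=> //; apply: (Hom_comp Hg); last by rewrite rent; exact: Hom_id.
  move=> i; rewrite inE => /orP [/eqP -> | iA]; first by rewrite /ren eqxx mem_head.
  by rewrite renA // inE iA orbT.
move=> f f' [[fA fA' Hf Hf'] ef].
have renx : ren x = y by rewrite /ren eqxx.
have renf h : {in A, h =1 id} -> {in A, h \o ren =1 id}.
  by move=> hA i iA; rewrite /= renA // hA.
have rentf h : fmap (h \o ren) tc = fmap h tc by rewrite -fmap_comp rent.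
suff [fy fyA Ef] : [/\ f y = f' y, f y \in x :: A &
    E1 (f \o ren) (f' \o ren) \/ hrel (x :: A) cs tc (f \o ren) (f' \o ren)].
  have /ffunP := cg _ _ Ef; rewrite -index_mem in fyA.
  move=> /(_ (Ordinal fyA)); rewrite !ffunE (nth_index 0); last by rewrite -index_mem.
  by rewrite /= !fmap_comp fy.
have xNA : f y \in A -> f y == x = false by move=> fyA; apply: contraNF xA => /eqP <-.
have xNA' : f' y \in A -> f' y == x = false by move=> fyA; apply: contraNF xA => /eqP <-.
case: Hf => [[fy Hc _] | [fyA Hc _] | [_ _ []]];
  case: Hf' => [[fy' Hc' _] | [fyA' Hc' _] | [_ _ []]].
- rewrite fy fy' mem_head; split=> //; right.
  have ext h : h y = x -> {in A, h =1 id} -> {in x :: A, h \o ren =1 id}.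
    move=> hy hA i; rewrite inE => /orP [/eqP -> | /renf]; last exact.
    by rewrite /= renx.
  by split; rewrite ?rentf //; exact: ext.
- move: ef; rewrite /= fy eqxx xNA' //.
  by have [p ->] := dpath_some xA Hc'.
- move: ef; rewrite /= fy' eqxx xNA //.
  by have [p ->] := dpath_some xA Hc.
move: ef; rewrite /= xNA // xNA' //.
have [p ep] := dpath_some xA Hc; have [p' ep'] := dpath_some xA Hc'.
rewrite ep ep' => -[fy pp']; split=> //; first by rewrite inE fyA orbT.
left; split=> /=; rewrite ?renx //; split; last by rewrite !rentf ep ep' pp'.
by split; rewrite ?rentf //; exact: renf.
Qed.

(** The path starts with [None] exactly when [x] lies in a later tree, and then the first tree holds
    constants only; otherwise the later trees carry a word onto [rs]. Each factor of [arrow_cons]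
    therefore needs a union of two relations. The forest [rs] varies in the induction because only
    the first tree of the target can move into the children. *)
Lemma arrow_path A a0 x cs rs t : a0 \in A -> x \notin A -> x \notin labels t ->
  ramsey (x :: A) cs -> ramsey A rs ->
  arrow A t (prel A (Node x cs rs) x t).
Proof.
move=> a0A xA xt Hcs; elim: t rs xt => [|y tc IHc tr IHr] rs xt Hrs.
  exact: arrow_nil.
move: xt; rewrite /= inE mem_cat !negb_or => /and3P [xy xtc xtr].
have HLeaf : ramsey A Leaf by move=> t; exact: arrow_words a0A.
have hA s1 t1 f f' : hrel A s1 t1 f f' -> {in A, forall a, f a = f' a /\ f a \in A}.
  by case=> fA fA' _ _ a aA; rewrite fA // fA'.
have tree := arrow_path_tree y xA xtc Hcs (IHc Leaf xtc HLeaf).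
have {}tree := arrow_union_ramsey (fun f f' (H : prel _ _ _ _ f f') => hA _ _ _ _ H.1)
  tree HLeaf.
have right := arrow_union_ramsey (fun f f' (H : prel _ _ _ _ f f') => hA _ _ _ _ H.1)
  (IHr rs xtr Hrs) Hrs.
apply: (arrow_cons (B := A ++ labels (Node x cs rs)) a0A _ _ tree right); last first.
  by move=> f f' [/hrel_into].
move=> f f' [[fA fA' Hf Hf'] ef].
have leftE h : Hom A (Node x cs Leaf) (fmap h (Node y tc Leaf)) ->
    dpath x (fmap h (Node y tc tr)) = dpath x (fmap h (Node y tc Leaf)) /\
    exists a p, dpath x (fmap h (Node y tc Leaf)) = Some (map Some a ++ p) /\
      (dpath x (fmap h (Node y tc Leaf)) = Some [::] \/ exists b, a = [:: b]).
  rewrite /=; case: eqP => [-> _ | hy]; first by split=> //; exists [::], [::]; split; auto.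
  case=> [[/esym] | [hyA Hc _] | [_ _ []]]; first by move/esym.
  have [p ->] := dpath_some xA Hc; split=> //.
  by exists [:: h y], p; split=> //; right; exists (h y).
have rightE h : Hom A Leaf (fmap h (Node y tc Leaf)) ->
    Hom A (Node x cs rs) (fmap h tr) -> exists p,
    dpath x (fmap h tr) = Some p /\ dpath x (fmap h (Node y tc tr)) = Some (None :: p).
  move=> /Hom0 /sub_labels_node [hy hc _] /(dpath_some xA) [p ep].
  exists p; rewrite /= ep (dpath_none xA hc) ifN //.
  by apply: contraNneq xA => <-.
case/Hom_split: Hf => [[H1 H2] | [H1 H2]]; case/Hom_split: Hf' => [[H1' H2'] | [H1' H2']].
- split; rewrite ?fA ?fA' //; last by right.
  by left; split=> //; rewrite -(leftE _ H1).1 -(leftE _ H1').1.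
- have [e1 [a [p [e2 e3]]]] := leftE _ H1; have [p' [_ e4]] := rightE _ H1' H2'.
  move: ef; rewrite e1 e4; case: e3 => [-> // | [b ab]].
  by rewrite e2 ab.
- have [e1 [a [p [e2 e3]]]] := leftE _ H1'; have [p' [_ e4]] := rightE _ H1 H2.
  move: ef; rewrite e1 e4; case: e3 => [-> // | [b ab]].
  by rewrite e2 ab.
- have [p [e1 e2]] := rightE _ H1 H2; have [p' [e1' e2']] := rightE _ H1' H2'.
  move: ef; rewrite e2 e2' => -[epp].
  split; rewrite ?fA ?fA' //; first by right.
  by left; split=> //; rewrite e1 e1' epp.
Qed.

(** * Colourings of positions *)

(* Words are accumulated in reverse. While reading the variable word g under the
   valuation r, with k variables already seen, a variable of index at least k
   counts as the k-th new one; the colour D of the word read so far must then be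
   col k, whatever r is. *)
Fixpoint level_homogeneous (A : seq nat) (C : Type) (D : seq nat -> C)
    (col : nat -> C) (r : nat -> nat) (k : nat) (w : seq nat)
    (g : seq (nat + nat)) : Prop :=
  match g with
  | [::] => True
  | inl a :: g' => a \in A /\ level_homogeneous A D col r k (a :: w) g'
  | inr j :: g' =>
    if j < k then level_homogeneous A D col r k (r j :: w) g'
    else D w = col k /\ level_homogeneous A D col r k.+1 (r k :: w) g'
  end.

(** The weight [P] lets the same recursion count all first occurrences of variables or only those at
    levels of a chosen colour. *)
Fixpoint nb_new (P : pred nat) (k : nat) (g : seq (nat + nat)) : nat :=
  match g with
  | [::] => 0
  | inl _ :: g' => nb_new P k g'
  | inr j :: g' => if j < k then nb_new P k g' else P k + nb_new P k.+1 g'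
  end.

Definition line_word : seq (option nat) -> seq (nat + nat) :=
  map (fun o => if o is Some a then inl a else inr 0).

Definition shift_word : seq (nat + nat) -> seq (nat + nat) :=
  map (fun l => match l with inl a => inl a | inr j => inr j.+1 end).

Lemma homogeneous_line1 A C (D : seq nat -> C) col r w l g :
  (forall a, Some a \in l -> a \in A) ->
  level_homogeneous A D col r 1 (catrev (fill (r 0) l) w) g ->
  level_homogeneous A D col r 1 w (line_word l ++ g).
Proof.
elim: l w => [|[a|] l IHl] w //= lA H.
  split; first by apply: lA; rewrite mem_head.
  by apply: IHl => // b bl; apply: lA; rewrite inE bl orbT.
by apply: IHl => // b bl; apply: lA; rewrite inE bl orbT.
Qed.

(** Only constants precede the first [None], so the filling letter [0] in the hypothesis on [D] is a
    dummy. *)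
Lemma homogeneous_line0 A C (D : seq nat -> C) col r w l g :
  (forall a, Some a \in l -> a \in A) -> None \in l ->
  D (catrev (fill 0 (take (index None l) l)) w) = col 0 ->
  level_homogeneous A D col r 1 (catrev (fill (r 0) l) w) g ->
  level_homogeneous A D col r 0 w (line_word l ++ g).
Proof.
elim: l w => [|[a|] l IHl] w //= lA nl Dw H.
  split; first by apply: lA; rewrite mem_head.
  by apply: IHl => // b bl; apply: lA; rewrite inE bl orbT.
by split=> //; apply: homogeneous_line1 => // b bl; apply: lA; rewrite inE bl orbT.
Qed.

(** Words being reversed, the block [v] read earlier is a suffix. Levels are bounded by [m] because
    the colouring that will supply the first hypothesis records only finitely many of them. *)
Lemma homogeneous_shift A C C' (D : seq nat -> C) (D' : seq nat -> C') col col'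
    r k w v g m :
  (forall k' w', k' < m -> D' w' = col' k' -> D (w' ++ v) = col k'.+1) ->
  k + nb_new predT k g <= m ->
  level_homogeneous A D' col' (r \o succn) k w g ->
  level_homogeneous A D col r k.+1 (w ++ v) (shift_word g).
Proof.
move=> HD; elim: g k w => [|[a|j] g IHg] k w //= km.
  by case=> aA H; split=> //; exact: (IHg _ (a :: w) km H).
rewrite ltnS; case: ifP km => _ km H; first exact: (IHg _ (r j.+1 :: w) km H).
move: km H; rewrite addnA addn1 => km [Dw H].
split; last exact: (IHg _ (r k.+1 :: w) km H).
by apply: HD => //; exact: leq_trans (leq_addr _ _) km.
Qed.

Lemma nb_new_line1 P l g : nb_new P 1 (line_word l ++ g) = nb_new P 1 g.
Proof. by elim: l => [|[a|] l IHl]. Qed.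

Lemma nb_new_line0 P l g : None \in l ->
  nb_new P 0 (line_word l ++ g) = P 0 + nb_new P 1 g.
Proof. by elim: l => [|[a|] l IHl] //=; rewrite nb_new_line1. Qed.

Lemma nb_new_shift P k g :
  nb_new P k.+1 (shift_word g) = nb_new (P \o succn) k g.
Proof. by elim: g k => [|[a|j] g IHg] k //=; rewrite !IHg ltnS. Qed.

(* A finite form of the Carlson-Simpson theorem, obtained by stacking
   Hales-Jewett blocks. *)
Lemma carlson_simpson (A : seq nat) a0 m (C : finType) : a0 \in A ->
  exists n, forall D : seq nat -> C, exists g col,
    [/\ size g = n, consts_in A g,
        forall P, nb_new P 0 g = \sum_(k < m) P k &
        forall r, (forall j, r j \in A) -> level_homogeneous A D col r 0 [::] g].
Proof.
move=> a0A; elim: m C => [|m IHm] C.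
  exists 0 => D; exists [::], (fun _ => D [::]); split=> // P.
  by rewrite big_ord0.
have [M HM] := hales_jewett A {ffun 'I_m -> C}.
have [nW [W HW]] := finite_seqs A M.
have [n' Hn'] := IHm {ffun 'I_nW -> C}.
exists (M + n') => D.
have [g [col' [Sg gA gnew gcol]]] := Hn' (fun w => [ffun i => D (w ++ W i)]).
pose pick_word v := [pick i | W i == rev v].
(* The level colours [col'] of [g] depend on the block read before it; the line makes them the same
   for all its fillings by letters of [A]. *)
have [l [Sl nl lA cl]] := HM (fun v => [ffun k : 'I_m =>
  if pick_word v is Some i then col' k i else D [::]]).
pose c0 k := if pick_word (fill a0 l) is Some i then col' k i else D [::].
pose col k := if k is k'.+1 then c0 k' else D (rev (fill 0 (take (index None l) l))).
exists (line_word l ++ shift_word g), col; split.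
- by rewrite size_cat !size_map Sl Sg.
- move=> a; rewrite mem_cat => /orP [] /mapP [[b|j] bl] // [->]; [exact: lA | exact: gA].
- move=> P; rewrite nb_new_line0 // nb_new_shift gnew big_ord_recl; congr (_ + _).
move=> r rA; apply: homogeneous_line0 => //.
apply: (homogeneous_shift (D' := fun w => [ffun i => D (w ++ W i)]) (col' := col')
  (w := [::]) (m := m)); last by apply: gcol => j; exact: rA.
  move=> k w km e; pose v := fill (r 0) l.
  have [i Wi] : exists i, W i = rev v.
    apply: HW => [|b]; first by rewrite size_rev size_map.
    rewrite mem_rev => /mapP [[a /lA aA | _] -> //]; exact: rA.
  have /ffunP /(_ (Ordinal km)) := cl _ _ (rA 0) a0A; rewrite !ffunE -/(c0 k) /col => <-.
  rewrite /pick_word; case: pickP => [i' /eqP Wi' | /(_ i)]; last by rewrite Wi eqxx.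
  by rewrite -e ffunE Wi'.
by rewrite gnew add0n sum1_card card_ord.
Qed.

Lemma pigeonhole_sum (C : finType) (col : nat -> C) h (m := (#|C| * h).+1) :
  exists i, h <= \sum_(k < m) (col k == i).
Proof.
have [/existsP // | /existsPn no] := boolP [exists i, h <= \sum_(k < m) (col k == i)].
have : \sum_(i : C) \sum_(k < m) (col k == i) = m.
  rewrite exchange_big /= -[RHS]card_ord -sum1_card; apply: eq_bigr => k _.
  rewrite (bigD1 (col k)) //= eqxx big1 ?addn0 // => i ni.
  by rewrite eq_sym (negbTE ni).
have : \sum_(i : C) \sum_(k < m) (col k == i) <= #|C| * h.
  rewrite -sum_nat_const; apply: leq_sum => i _; rewrite ltnW //.
  by rewrite ltnNge no.
by move=> le e; move: le; rewrite e ltnn.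
Qed.

(** * Branching subtrees in which the colour depends on the labels only *)

Definition sibling_colouring (C : Type) (d : seq nat -> seq (option nat) -> C) :=
  fun w p => d w (None :: p).

Definition child_colouring (C : Type) (d : seq nat -> seq (option nat) -> C) :=
  fun w p => if w is a :: w' then d w' (Some a :: p) else d w p.

(* A position in u is coloured by d w p, where w lists the labels met before
   entering u and p is the path inside u. [good] says that u contains j trees
   that branch m times at each of n levels and in which the colour of a node
   at a word of labels is D of that word: it depends on the level only. *)
Fixpoint good (A : seq nat) (C : Type) (D : seq nat -> C) (m n j l : nat)
    (u : forest unit) (d : seq nat -> seq (option nat) -> C) {struct u} : Prop :=
  match n, j with
  | n'.+1, j'.+1 =>
    if u is Node _ c r then
      good A D m n j l r (sibling_colouring d) \/
      [/\ forall w, size w = l -> {subset w <= A} -> d w [::] = D w,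
          good A D m n' m l.+1 c (child_colouring d) &
          good A D m n j' l r (sibling_colouring d)]
    else False
  | _, _ => True
  end.

Lemma good_ext A C (D D' : seq nat -> C) m n j l u d :
  (forall w, {subset w <= A} -> l <= size w < l + n -> D w = D' w) ->
  good A D m n j l u d -> good A D' m n j l u d.
Proof.
elim: u n j l d => [|[] c IHc r IHr] [|n] [|j] l d //= DD'.
case=> [H | [H1 H2 H3]]; [left | right]; first exact: IHr H.
split; [| apply: IHc H2 | exact: IHr H3].
  move=> w Sw wA; rewrite H1 // DD' // Sw leqnn /=.
  by rewrite -[X in X < _]addn0 ltn_add2l.
move=> w wA /andP [lw wl]; apply: DD' => //.
by rewrite (ltnW lw) -addSnnS.
Qed.

Lemma finite_seqs_lt (A : seq nat) n : exists N (F : 'I_N -> seq nat),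
  forall w, size w < n -> {subset w <= A} -> exists i, F i = w.
Proof.
elim: n => [|n [N [F HF]]]; first by exists 0, (fun _ => [::]).
have [N' [F' HF']] := finite_seqs A n.
exists (N + N'), (fun i => match split i with inl j => F j | inr j => F' j end) => w.
rewrite ltnS leq_eqVlt => /orP [/eqP Sw | Sw] wA.
  have [i <-] := HF' w Sw wA; exists (rshift N i).
  by rewrite (unsplitK (inr i : 'I_N + 'I_N')).
have [i <-] := HF w Sw wA; exists (lshift N' i).
by rewrite (unsplitK (inl i : 'I_N + 'I_N')).
Qed.

(** In a row of [#|V| * m] copies of the forest for [n], where [V] is the set of tables of [D] on
    the relevant words, some table occurs [m] times. [rowP] is this pigeonhole principle with a
    separate demand [need v] for each table, a form that passes along the row. *)
Lemma good_forest (A : seq nat) (C : finType) m n l :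
  exists u, forall d : seq nat -> seq (option nat) -> C,
  exists D, good A D m n m l u d.
Proof.
elim: n l => [|n IHn] l; first by exists Leaf => d; exists (fun _ => d [::] [::]).
have [uc Huc] := IHn l.+1.
have [N [W HW]] := finite_seqs_lt A (l + n).+1.
pose V := {ffun 'I_N -> C}; pose row k := iter k (Node tt uc) Leaf.
exists (row (#|V| * m)) => d; pose d0 := d [::] [::].
pose toD (v : V) w := if [pick i | W i == w] is Some i then v i else d0.
have toDE D w : size w < (l + n).+1 -> {subset w <= A} ->
    toD [ffun i => D (W i)] w = D w.
  move=> Sw wA; rewrite /toD; case: pickP => [i /eqP <- | no]; first by rewrite ffunE.
  by have [i Wi] := HW w Sw wA; have := no i; rewrite Wi eqxx.
suff rowP k need d' : \sum_(v : V) need v <= k ->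
    exists v, good A (toD v) m n.+1 (need v) l (row k) d'.
  have [|v gv] := rowP (#|V| * m) (fun _ => m) d; first by rewrite sum_nat_const.
  by exists (toD v).
elim: k need d' => [|k IHk] need d' need_le.
  exists [ffun=> d0]; suff -> : need [ffun=> d0] = 0 by [].
  by apply/eqP; rewrite -leqn0 (leq_trans _ need_le) // (bigD1 [ffun=> d0]) //= leq_addr.
have [D1 HD1] := Huc (child_colouring d').
(* Words of length [l] get their value at the root of the first copy, longer ones inside it. *)
pose D2 w := if size w == l then d' w [::] else D1 w.
pose v1 : V := [ffun i => D2 (W i)].
case E: (need v1) => [|n1]; first by exists v1; rewrite E.
pose need' v := need v - (v == v1).
have [|v gv] := IHk need' (sibling_colouring d').
  rewrite -ltnS (leq_trans _ need_le) // (bigD1 v1) //= [X in _ < X](bigD1 v1) //=.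
  rewrite /need' eqxx E subn1 addSn ltnS leq_add2l leq_sum // => v /negbTE ->.
  by rewrite subn0.
exists v; case: (eqVneq v v1) gv => [-> | nv]; rewrite /need' ?eqxx ?(negbTE nv).
  rewrite E subn1 => gv /=; right; split=> //.
    move=> w Sw wA; rewrite toDE //; last by rewrite Sw ltnS leq_addr.
    by rewrite /D2 Sw eqxx.
  apply: good_ext HD1 => w wA /andP [lw wl]; rewrite toDE //.
  by rewrite /D2 gtn_eqF.
by rewrite subn0; case: (need v) => [//|n2] gv; left.
Qed.

(** * Placing the target in a good forest *)

Fixpoint nb_trees (L : Type) (t : forest L) : nat :=
  if t is Node _ _ r then (nb_trees r).+1 else 0.

Fixpoint arity (L : Type) (t : forest L) : nat :=
  if t is Node _ c r then maxn (nb_trees r).+1 (maxn (arity c) (arity r)) else 0.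

Lemma nb_trees_arity (L : Type) (t : forest L) : nb_trees t <= arity t.
Proof. by case: t => //= x c r; rewrite leq_maxl. Qed.

Fixpoint depth (L : Type) (t : forest L) : nat :=
  if t is Node _ c r then maxn (depth c).+1 (depth r) else 0.

Lemma skel_const (u : forest unit) (a0 : nat) : skel (fmap (fun=> a0) u) = u.
Proof. by rewrite skel_fmap; elim: u => //= -[] c {2}<- r {2}<-. Qed.

Lemma const_labels (u : forest unit) (a0 : nat) (A : seq nat) : a0 \in A ->
  {subset labels (fmap (fun=> a0) u) <= A}.
Proof. by move=> a0A i; rewrite labels_fmap => /mapP [_ _ ->]. Qed.

(* The roots of the target are placed at the levels of the good variables of h,
   those of colour i0; the other variables of h are replaced by a0. *)
Lemma place_target (A : seq nat) a0 x (C : eqType) (D : seq nat -> C) col i0 m h t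
    (O : seq nat) k eta j l u d :
  a0 \in A -> x \notin A -> consts_in A h ->
  good A D m (size h) j l u d ->
  nb_trees t <= j -> arity t <= m -> depth t <= nb_new (fun k => col k == i0) k h ->
  {subset A <= O} -> (forall j, j < k -> eta j \in O) ->
  exists g, [/\ skel g = u, Hom O t g &
    forall f cs rs w, {in A, f =1 id} -> {in O, forall i, f i \in A} ->
      size w = l -> {subset w <= A} ->
      (forall r, (forall j, r j \in A) -> (forall j, j < k -> r j = f (eta j)) ->
         level_homogeneous A D col r k w h) ->
      Hom A (Node x cs rs) (fmap f t) ->
      exists p, dpath x (fmap f g) = Some p /\ d w p = i0].
Proof.
move=> a0A xA; elim: h t O k eta j l u d => [|L h IHh] t O k eta j l u d hA.
  case: t => [|y tc tr] _ _ _ => [_|]; last by rewrite /= leqn0 -leqn0 geq_max.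
  move=> sAO _; exists (fmap (fun=> a0) u); split=> //; first exact: skel_const.
  by apply/Hom0 => i /(const_labels a0A) /sAO.
have hA' : consts_in A h by move=> a ah; apply: hA; rewrite inE ah orbT.
elim: u t j d => [|[] c _ r IHr] t j d.
  case: t => [|y tc tr] H tj _ _ sAO _; last by case: j H tj.
  by exists Leaf; split=> //; apply/Hom0.
case: t => [|y tc tr] gu tj tm td sAO etaO.
  exists (fmap (fun=> a0) (Node tt c r)); split=> //; first exact: skel_const.
  by apply/Hom0 => i /(const_labels a0A) /sAO.
have wordx w : {subset labels w <= A} -> dpath x w = None by exact: dpath_none.
have fx f b : f b \in A -> (f b == x) = false.
  by move=> fA; apply: contraNF xA => /eqP <-.
(* A tree that is not among the chosen ones is filled with [a0] and skipped. *)
case: j gu tj => // j gu tj; case: gu => [gr | [rootE gc gr]].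
  have [g [Sg Hg cg]] := IHr (Node y tc tr) j.+1 _ gr tj tm td sAO etaO.
  exists (Node a0 (fmap (fun=> a0) c) g); split.
  - by rewrite skel_node skel_const Sg.
  - by apply: Hom_right => //; [exact: sAO | move=> i /(const_labels a0A) /sAO].
  move=> f cs rs w fA fO Sw wA hw Hf.
  have [p [ep dp]] := cg f cs rs w fA fO Sw wA hw Hf.
  exists (None :: p); split=> //=.
  rewrite fx ?fO ?sAO // ep fmap_comp wordx // => i.
  by rewrite labels_fmap => /mapP [b _ ->] /=; rewrite fO ?sAO.
move: tm; rewrite /= !geq_max => /and3P [trm tcm trm'].
have tdc : depth tc < nb_new (fun k => col k == i0) k (L :: h).
  by move: td; rewrite [depth _]/= geq_max => /andP [].
have tdr : depth tr <= nb_new (fun k => col k == i0) k (L :: h).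
  by move: td; rewrite [depth _]/= geq_max => /andP [].
have [gR [SgR HgR cgR]] := IHr tr j _ gr tj trm' tdr sAO etaO.
have Hleaf A' : Hom A' Leaf Leaf by [].
have goRight f cs rs w b gC : {in A, f =1 id} -> {in O, forall i, f i \in A} ->
    size w = l -> {subset w <= A} ->
    (forall r, (forall j, r j \in A) -> (forall j, j < k -> r j = f (eta j)) ->
         level_homogeneous A D col r k w (L :: h)) ->
    f b \in A -> {subset labels (fmap f gC) <= A} ->
    Hom A (Node x cs rs) (fmap f tr) ->
    exists p, dpath x (fmap f (Node b gC gR)) = Some p /\ d w p = i0.
  move=> fA fO Sw wA hw fbA gCA Hf.
  have [p [ep dp]] := cgR f cs rs w fA fO Sw wA hw Hf.
  by exists (None :: p); split=> //=; rewrite fx // wordx // ep.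
(* At any letter of [h] other than a new variable of colour [i0], the node gets a known letter [b]
   and the first tree of the target moves on to the next level. The cases differ only in [b] and
   [eta']. *)
have goDown b k' eta' : b \in O ->
    depth tc < nb_new (fun k => col k == i0) k' h ->
    (forall j, j < k' -> eta' j \in O) ->
    (forall f w, {in A, f =1 id} -> {in O, forall i, f i \in A} ->
      (forall r, (forall j, r j \in A) -> (forall j, j < k -> r j = f (eta j)) ->
         level_homogeneous A D col r k w (L :: h)) ->
      (forall r, (forall j, r j \in A) -> (forall j, j < k' -> r j = f (eta' j)) ->
         level_homogeneous A D col r k' (f b :: w) h)) ->
    exists g, [/\ skel g = Node tt c r, Hom O (Node y tc tr) g &
    forall f cs rs w, {in A, f =1 id} -> {in O, forall i, f i \in A} ->
      size w = l -> {subset w <= A} ->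
      (forall r, (forall j, r j \in A) -> (forall j, j < k -> r j = f (eta j)) ->
         level_homogeneous A D col r k w (L :: h)) ->
      Hom A (Node x cs rs) (fmap f (Node y tc tr)) ->
      exists p, dpath x (fmap f g) = Some p /\ d w p = i0].
  move=> bO tdc' eta'O Hdown.
  have m1 : 0 < m by exact: leq_trans trm.
  have [|||||gC [SgC HgC cgC]] := IHh (Node y tc Leaf) O k' eta' m l.+1 c _ hA' gc.
  - by [].
  - by rewrite /= !geq_max m1 tcm.
  - by rewrite /= geq_max tdc'.
  - by [].
  - exact: eta'O.
  exists (Node b gC gR); split; first by rewrite skel_node SgC SgR.
    exact: Or32.
  move=> f cs rs w fA fO Sw wA hw; case/Hom_split=> [[H1 H2] | [H1 H2]].
    have [|b'|p [ep dp]] := cgC f cs Leaf (f b :: w) fA fO _ _ (Hdown f w fA fO hw) H1.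
    - by rewrite /= Sw.
    - by rewrite inE => /orP [/eqP -> | /wA //]; exact: fO.
    by exists (Some (f b) :: p); split=> //=; rewrite fx ?fO // ep.
  apply: (goRight f cs rs w) => //; first exact: fO.
  by apply/Hom0; exact: Hom_comp HgC fO H1.
clear IHr gr cgR td tdr.
case: L hA tdc goRight goDown => [a|i] hA tdc goRight goDown.
  apply: (goDown a k eta) => //; first by apply/sAO/hA; rewrite mem_head.
  move=> f w fA fO H r1 r1A r1E; rewrite fA ?hA ?mem_head //.
  by have [] := H r1 r1A r1E.
rewrite /= in tdc goRight goDown *.
move: tdc goRight goDown; case: ifP => ik tdc goRight goDown.
  apply: (goDown (eta i) k eta) => //; first exact: etaO.
  by move=> f w fA fO H r1 r1A r1E; rewrite -r1E //; exact: H.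
case: eqVneq tdc => [ck | nck] tdc; last first.
  apply: (goDown a0 k.+1 (fun j => if j == k then a0 else eta j)) => //.
  - exact: sAO.
  - move=> i' i'k; case: eqP => [_ | ne]; first exact: sAO.
    by apply: etaO; rewrite ltn_neqAle; apply/andP; split; [exact/eqP | rewrite -ltnS].
  move=> f w fA fO H r1 r1A r1E.
  have [|_] := H r1 r1A.
    move=> i' i'k; rewrite r1E; last exact: ltnW.
    by rewrite ltn_eqF.
  by rewrite r1E // eqxx.
(* A new variable at a level of colour [i0]: the root [y] is placed here and is the value of
   variable [k] from now on. *)
pose eta' j := if j == k then y else eta j.
have [|||||gC [SgC HgC cgC]] := IHh tc (y :: O) k.+1 eta' m l.+1 c _ hA' gc.
- exact: leq_trans (nb_trees_arity tc) tcm.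
- exact: tcm.
- by move: tdc; rewrite add1n ltnS.
- by move=> i' /sAO i'O; rewrite inE i'O orbT.
- move=> i' i'k; rewrite /eta'; case: eqP => [_ | ne]; first exact: mem_head.
  rewrite inE etaO ?orbT // ltn_neqAle; apply/andP; split; [exact/eqP | by rewrite -ltnS].
exists (Node y gC gR); split; first by rewrite skel_node SgC SgR.
  exact: Or31.
move=> f cs rs w fA fO Sw wA hw.
have fyO : f y \in A -> {in y :: O, forall i, f i \in A}.
  by move=> fyA b; rewrite inE => /orP [/eqP -> | /fO].
(* The colour at this node is the same for all valuations that extend the values met so far; any one
   of them will do. *)
pose r0 j := if j < k then f (eta j) else a0.
have [||Dw _] := hw r0.
- by move=> i'; rewrite /r0; case: ifP => // /etaO /fO.
- by move=> i' i'k; rewrite /r0 i'k.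
case/Hom_split=> [[[[fy _ _] | [fyA Hc _] | [_ _ []]] H2] | [H1 H2]].
- by exists [::]; rewrite /= fy eqxx rootE // Dw.
- have [|b'||p [ep dp]] := cgC f cs Leaf (f y :: w) fA (fyO fyA) _ _ _ Hc.
  + by rewrite /= Sw.
  + by rewrite inE => /orP [/eqP -> | /wA].
  + move=> r1 r1A r1E; have [|_] := hw r1 r1A.
      move=> i' i'k; rewrite r1E; last exact: ltnW.
      by rewrite /eta' ltn_eqF.
    by rewrite r1E // /eta' eqxx.
  by exists (Some (f y) :: p); split=> //=; rewrite fx // ep.
case/sub_labels_node: (H1) => fyA fcA _.
apply: (goRight f cs rs w) => //.
by apply/Hom0; apply: Hom_comp HgC (fyO fyA) _; apply/Hom0.
Qed.

(** * The Ramsey theorem for forests *)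

Lemma ramsey_node (A : seq nat) a0 x cs rs : a0 \in A -> x \notin A ->
  ramsey (x :: A) cs -> ramsey A rs -> ramsey A (Node x cs rs).
Proof.
move=> a0A xA Hcs Hrs t C; set s := Node x cs rs.
(* With this many levels some colour occurs on at least [depth t] of them. *)
have [n Hn] := carlson_simpson (#|C| * depth t).+1 C a0A.
have [u1 Hu1] := good_forest A C (arity t) n 0.
have [k Ak] := seq_bound (x :: A).
have [t1 [St1 Ut1 Bt1]] := fresh_forest k u1.
have xk : x \notin labels t1.
  by apply/negP => /Bt1; rewrite leqNgt Ak ?mem_head.
have [u Hu] := arrow_path a0A xA xk Hcs Hrs C.
exists u => c; have [g1 [Sg1 Hg1 cg1]] := Hu c.
pose P p i := exists f, [/\ {in A, f =1 id}, Hom A s (fmap f t1),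
  dpath x (fmap f t1) = Some p & c (fmap f g1) = i].
(* By the choice of [g1] all words with path [p] have one colour, which [epsilon] names; a path that
   no word realises gets an arbitrary colour. *)
pose d (w : seq nat) p := epsilon (inhabits (c Leaf)) (P p).
have dE f p : {in A, f =1 id} -> Hom A s (fmap f t1) ->
    dpath x (fmap f t1) = Some p -> c (fmap f g1) = d [::] p.
  move=> fA Hf ep; have exP : exists i, P p i by exists (c (fmap f g1)), f.
  have [f' [fA' Hf' ep' ed]] := epsilon_spec (inhabits (c Leaf)) (P p) exP.
  by rewrite /d -ed; apply: cg1; split; [split | rewrite ep ep'].
have [D HD] := Hu1 d.
have [h [col [Sh hA hnew hcol]]] := Hn D; subst n.
have [i0 Hi0] := pigeonhole_sum col (depth t).
have [|||||g2 [Sg2 Hg2 cg2]] := place_target (O := A) (k := 0) (eta := id) (i0 := i0)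
  (col := col) (t := t) a0A xA hA HD.
- exact: nb_trees_arity.
- by [].
- by rewrite hnew.
- by [].
- by [].
pose sg := subst t1 g2 id.
have sgA : {in A, sg =1 id}.
  move=> i iA; rewrite /sg subst_out //; apply/negP => /Bt1.
  by rewrite leqNgt Ak // inE iA orbT.
have sgt : fmap sg t1 = g2 by rewrite subst_in // Sg2.
exists (fmap sg g1); split; first by rewrite skel_fmap.
  by apply: (Hom_comp Hg1); [move=> i iA; rewrite sgA | rewrite sgt].
suff key f : {in A, f =1 id} -> Hom A s (fmap f t) -> c (fmap f (fmap sg g1)) = i0.
  by move=> f f' [fA fA' Hf Hf']; rewrite !key.
move=> fA Hf; have fAA : {in A, forall i, f i \in A} by move=> i iA; rewrite fA.
have [|||p [ep dp]] := cg2 f cs rs [::] fA fAA _ _ _ Hf; [by [] | by [] | |].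
  by move=> r rA _; exact: hcol.
have ft1 : fmap (f \o sg) t1 = fmap f g2 by rewrite -fmap_comp sgt.
rewrite fmap_comp (dE _ p) ?ft1 //; first by move=> i iA; rewrite /= sgA // fA.
exact: Hom_comp Hg2 fAA Hf.
Qed.

(** A label has to be new only relative to the constants and to the nodes below it, since these are
    the constants of the recursive call. *)
Fixpoint admissible (A : seq nat) (s : word) : bool :=
  if s is Node x c r then [&& x \notin A, admissible (x :: A) c & admissible A r]
  else true.

Lemma ramsey_forest (A : seq nat) a0 s : a0 \in A -> admissible A s -> ramsey A s.
Proof.
elim: s A => [|x cs IHc rs IHr] A a0A; first by move=> _ t; exact: arrow_words a0A.
case/and3P=> xA adc adr; apply: (ramsey_node a0A xA); last exact: IHr.
by apply: IHc => //; rewrite inE a0A orbT.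
Qed.

(** * Forests of positions and ordered trees *)

Fixpoint pos (u : forest unit) : finType :=
  if u is Node _ c r then option (pos c + pos r)%type else void.

(* [None] when p and q lie in different trees of the forest. *)
Fixpoint fmeet (u : forest unit) : pos u -> pos u -> option (pos u) :=
  match u return pos u -> pos u -> option (pos u) with
  | Leaf => fun _ _ => None
  | Node _ c r => fun p q =>
    match p, q with
    | None, None | None, Some (inl _) | Some (inl _), None => Some None
    | Some (inl p'), Some (inl q') =>
      Some (if fmeet p' q' is Some m then Some (inl m) else None)
    | Some (inr p'), Some (inr q') =>
      if fmeet p' q' is Some m then Some (Some (inr m)) else None
    | _, _ => None
    end
  end.

Definition fle u (p q : pos u) : bool := fmeet p q == Some p.

Fixpoint ple (u : forest unit) : rel (pos u) :=
  match u return rel (pos u) with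
  | Leaf => fun _ _ => true
  | Node _ c r => fun p q =>
    match p, q with
    | None, _ => true
    | Some (inl p'), Some (inl q') => ple p' q'
    | Some (inl _), Some (inr _) => true
    | Some (inr p'), Some (inr q') => ple p' q'
    | _, _ => false
    end
  end.

Fixpoint tab (L : Type) (u : forest unit) : (pos u -> L) -> forest L :=
  match u return (pos u -> L) -> forest L with
  | Leaf => fun _ => Leaf
  | Node _ c r => fun h =>
    Node (h None) (tab (fun p => h (Some (inl p)))) (tab (fun p => h (Some (inr p))))
  end.

Fixpoint lookup (u : forest unit) (w : word) : pos u -> nat :=
  match u return pos u -> nat with
  | Leaf => fun _ => 0
  | Node _ c r => fun p =>
    if w is Node a wc wr then
      match p with
      | None => a
      | Some (inl p') => lookup wc p'
      | Some (inr p') => lookup wr p'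
      end
    else 0
  end.

Lemma fmap_tab (L M : Type) (f : L -> M) u (h : pos u -> L) :
  fmap f (tab h) = tab (f \o h).
Proof. by elim: u h => //= l c IHc r IHr h; rewrite IHc IHr. Qed.

Lemma eq_tab (L : Type) u (h h' : pos u -> L) : h =1 h' -> tab h = tab h'.
Proof.
elim: u h h' => //= l c IHc r IHr h h' e.
by rewrite e (IHc _ (fun p => h' (Some (inl p)))) // (IHr _ (fun p => h' (Some (inr p)))).
Qed.

Lemma labels_tab (L : eqType) u (h : pos u -> L) i :
  i \in labels (tab h) <-> exists p, h p = i.
Proof.
elim: u h i => [|l c IHc r IHr] h i; first by split=> [|[[]]].
rewrite /= inE mem_cat; split.
  case/or3P=> [/eqP -> | /IHc [p <-] | /IHr [p <-]]; first by exists None.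
    by exists (Some (inl p)).
  by exists (Some (inr p)).
case=> [[[p|p]|] <-]; rewrite ?eqxx //; apply/or3P.
  by apply: Or32; apply/IHc; exists p.
by apply: Or33; apply/IHr; exists p.
Qed.

Lemma tab_lookup u w : skel w = u -> tab (@lookup u w) = w.
Proof. by move=> <-; elim: w => //= a c IHc r IHr; rewrite IHc IHr. Qed.

Lemma fmeetxx u (p : pos u) : fmeet p p = Some p.
Proof.
by elim: u p => [[]|l c IHc r IHr [[p|p]|]] //=; rewrite ?IHc ?IHr.
Qed.

Lemma fle_node l c r (p q : pos (Node l c r)) : fle p q =
  match p, q with
  | None, None | None, Some (inl _) => true
  | Some (inl p'), Some (inl q') => fle p' q'
  | Some (inr p'), Some (inr q') => fle p' q'
  | _, _ => false
  end.
Proof. by case: p q => [[p|p]|] [[q|q]|]; rewrite /fle //=; case: (fmeet p q). Qed.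

(** * Words as rigid maps between forests of positions *)

Record rigid (A : seq nat) u s (nu : pos s -> nat) (phi : pos u -> nat)
    (e : pos s -> pos u) : Prop := Rigid {
  rigid_section : forall p, phi (e p) = nu p;
  rigid_below : forall q, phi q \in A \/ exists p, phi q = nu p /\ fle (e p) q;
  rigid_meet : forall p q, fmeet (e p) (e q) = omap e (fmeet p q);
  rigid_lex : forall p q, ple p q -> ple (e p) (e q) }.

(** The clauses of [Hom] correspond to the place of [e None]. When it lies in the first tree, the
    later target trees, having no meet with it, go to the right of that tree. When it lies in a
    later tree, the lexicographic order leaves no room in the first one. *)
Lemma rigid_Hom A u s (nu : pos s -> nat) (phi : pos u -> nat) e :
  injective nu -> rigid A nu phi e -> Hom A (tab nu) (tab phi).
Proof.
elim: u A s nu phi e => [|[] uc IHc ur IHr] A [|l sc sr] nu phi e nuI [e1 e2 e3 e4].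
- by [].
- by case: (e None).
- apply/Hom0 => i /labels_tab [q <-]; by case: (e2 q) => // [[[]]].
have eI p q : e p = e q -> p = q by move=> epq; apply: nuI; rewrite -!e1 epq.
have nuIl : injective (fun p => nu (Some (inl p))) by move=> p q /nuI [].
have nuIr : injective (fun p => nu (Some (inr p))) by move=> p q /nuI [].
case E0: (e None) => [[q0|q0]|].
- have el p : exists q, e (Some (inl p)) = Some (inl q).
    have := e3 None (Some (inl p)); rewrite E0 /= E0.
    by case: (e _) => [[q|q]|] // _; exists q.
  have er p : exists q, e (Some (inr p)) = Some (inr q).
    have := e3 None (Some (inr p)); rewrite E0 /=.
    by case: (e _) => [[q|q]|] // _; exists q.
  have [el' elE] := fin_all_exists el; have [er' erE] := fin_all_exists er.
  apply: Or32; split.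
  + case: (e2 None) => // -[p [_]]; case: p => [[p|p]|].
    * by rewrite elE.
    * by rewrite erE.
    * by rewrite E0.
  + pose nu' (p : pos (Node tt sc Leaf)) := match p with
      None => nu None | Some (inl p') => nu (Some (inl p')) | Some (inr p') =>
      match p' with end end.
    pose e' (p : pos (Node tt sc Leaf)) := match p with
      None => q0 | Some (inl p') => el' p' | Some (inr p') => match p' with end end.
    apply: (IHc A (Node tt sc Leaf) nu' _ e').
      by move=> [[p|[]]|] [[q|[]]|] //= /nuI // [->].
    split.
    * by move=> [[p|[]]|] /=; rewrite -?elE -?E0 e1.
    * move=> q; case: (e2 (Some (inl q))) => [|[p [ep pq]]]; first by left.
      right; case: p ep pq => [[p|p]|] ep.
      - by rewrite elE fle_node; exists (Some (inl p)).
      - by rewrite erE.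
      - by rewrite E0 fle_node; exists None.
    * move=> [[p|[]]|] [[q|[]]|] /=.
      - have := e3 (Some (inl p)) (Some (inl q)); rewrite !elE /=.
        case: (fmeet p q) => [m|] /=; rewrite ?elE ?E0; by case: fmeet => // m' [->].
      - have := e3 (Some (inl p)) None; rewrite !elE E0 /= E0.
        by case: fmeet => // m' [->].
      - have := e3 None (Some (inl q)); rewrite !elE E0 /= E0.
        by case: fmeet => // m' [->].
      - exact: fmeetxx.
    * move=> [[p|[]]|] [[q|[]]|] //= pq.
      - by have := e4 (Some (inl p)) (Some (inl q)) pq; rewrite !elE.
      - by have := e4 None (Some (inl q)) pq; rewrite !elE E0.
      - by have := e4 None None pq; rewrite !E0.
  + apply: (IHr A sr _ _ er') => //; split.
    * by move=> p; rewrite -erE e1.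
    * move=> q; case: (e2 (Some (inr q))) => [|[p [ep pq]]]; first by left.
      right; case: p ep pq => [[p|p]|] ep.
      - by rewrite elE.
      - by rewrite erE fle_node; exists p.
      - by rewrite E0.
    * move=> p q; have := e3 (Some (inr p)) (Some (inr q)); rewrite !erE /=.
      by case: (fmeet p q) => [m|] /=; rewrite ?erE; case: fmeet => // m' [->].
    * by move=> p q pq; have := e4 (Some (inr p)) (Some (inr q)) pq; rewrite !erE.
- have er p : exists q, e p = Some (inr q).
    have := e4 None p isT; rewrite E0 /=.
    by case: (e p) => [[q|q]|] // _; exists q.
  have [er' erE] := fin_all_exists er.
  apply: Or33; split.
  + by case: (e2 None) => // -[p [_]]; rewrite erE.
  + move=> i /labels_tab [q <-].
    by case: (e2 (Some (inl q))) => // -[p [_]]; rewrite erE.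
  + apply: (IHr A (Node l sc sr) nu _ er') => //; split.
    * by move=> p; rewrite -erE e1.
    * move=> q; case: (e2 (Some (inr q))) => [|[p [ep pq]]]; first by left.
      by right; exists p; split=> //; move: pq; rewrite erE fle_node.
    * move=> p q; have := e3 p q; rewrite !erE; case: (fmeet p q) => [m|];
        rewrite /= ?erE; by case: fmeet => // m' [->].
    * by move=> p q pq; have := e4 p q pq; rewrite !erE.
- have el p : exists q, e (Some (inl p)) = Some (inl q).
    have := e3 None (Some (inl p)); rewrite E0 /= E0.
    case E: (e _) => [[q|q]|] // _; first by exists q.
    by move: E; rewrite -E0 => /eI.
  have er p : exists q, e (Some (inr p)) = Some (inr q).
    have := e3 None (Some (inr p)); rewrite E0 /=.
    by case: (e _) => [[q|q]|] // _; exists q.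
  have [el' elE] := fin_all_exists el; have [er' erE] := fin_all_exists er.
  apply: Or31; split.
  + by rewrite -E0 e1.
  + apply: (IHc _ sc _ _ el') => //; split.
    * by move=> p; rewrite -elE e1.
    * move=> q; case: (e2 (Some (inl q))) => [qA|[p [ep pq]]].
        by left; rewrite inE qA orbT.
      case: p ep pq => [[p|p]|] ep.
      - by rewrite elE fle_node; right; exists p.
      - by rewrite erE.
      - by left; rewrite ep mem_head.
    * move=> p q; have := e3 (Some (inl p)) (Some (inl q)); rewrite !elE /=.
      by case: (fmeet p q) => [m|] /=; rewrite ?elE ?E0; case: fmeet => // m' [->].
    * by move=> p q pq; have := e4 (Some (inl p)) (Some (inl q)) pq; rewrite !elE.
  + apply: (IHr _ sr _ _ er') => //; split.
    * by move=> p; rewrite -erE e1.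
    * move=> q; case: (e2 (Some (inr q))) => [qA|[p [ep pq]]]; first by left.
      case: p ep pq => [[p|p]|] ep.
      - by rewrite elE.
      - by rewrite erE fle_node; right; exists p.
      - by rewrite E0.
    * move=> p q; have := e3 (Some (inr p)) (Some (inr q)); rewrite !erE /=.
      by case: (fmeet p q) => [m|] /=; rewrite ?erE; case: fmeet => // m' [->].
    * by move=> p q pq; have := e4 (Some (inr p)) (Some (inr q)) pq; rewrite !erE.
Qed.

Lemma Hom_rigid A u s (nu : pos s -> nat) (phi : pos u -> nat) :
  Hom A (tab nu) (tab phi) -> exists e, rigid A nu phi e.
Proof.
elim: u A s nu phi => [|[] uc IHc ur IHr] A [|l sc sr] nu phi.
- by exists (fun p => p); split=> [[]|[]|[]|[]].
- by [].
- move/Hom0 => H; exists (fun p : void => match p with end); split=> [[]||[]|[]] q.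
  by left; apply: H; apply/labels_tab; exists q.
case=> [[phi0 /IHc [ec [c1 c2 c3 c4]] /IHr [er [r1 r2 r3 r4]]]
       |[phi0 H1 /IHr [er [r1 r2 r3 r4]]]
       |[phi0 H1 /(IHr A (Node l sc sr)) [er [r1 r2 r3 r4]]]].
- pose e (p : pos (Node l sc sr)) : pos (Node tt uc ur) :=
    match p with None => None | Some (inl p') => Some (inl (ec p'))
    | Some (inr p') => Some (inr (er p')) end.
  exists e; split.
  + by move=> [[p|p]|] /=.
  + move=> [[q|q]|] /=.
    * case: (c2 q) => [|[p [ep pq]]]; last first.
        by right; exists (Some (inl p)); split=> //; rewrite fle_node.
      rewrite inE => /orP [/eqP qx|]; last by left.
      by right; exists None.
    * case: (r2 q) => [|[p [ep pq]]]; first by left.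
      by right; exists (Some (inr p)); split=> //; rewrite fle_node.
    * by right; exists None.
  + by move=> [[p|p]|] [[q|q]|] //=; rewrite ?c3 ?r3; case: fmeet.
  + by move=> [[p|p]|] [[q|q]|] //= pq; [apply: c4 | apply: r4].
- pose nu' (p : pos (Node tt sc Leaf)) := match p with
    None => nu None | Some (inl p') => nu (Some (inl p')) | Some (inr p') =>
    match p' with end end.
  have [ec [c1 c2 c3 c4]] := IHc A (Node tt sc Leaf) nu' _ H1.
  pose e (p : pos (Node l sc sr)) : pos (Node tt uc ur) :=
    match p with None => Some (inl (ec None))
    | Some (inl p') => Some (inl (ec (Some (inl p'))))
    | Some (inr p') => Some (inr (er p')) end.
  exists e; split.
  + by move=> [[p|p]|] /=; rewrite ?c1.
  + move=> [[q|q]|] /=; last by left.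
      case: (c2 q) => [|[p [ep pq]]]; first by left.
      case: p ep pq => [[p|[]]|] ep pq; right.
        by exists (Some (inl p)); split=> //; rewrite fle_node.
      by exists None; split=> //; rewrite fle_node.
    case: (r2 q) => [|[p [ep pq]]]; first by left.
    by right; exists (Some (inr p)); split=> //; rewrite fle_node.
  + by move=> [[p|p]|] [[q|q]|] /=; rewrite ?c3 ?r3 //=; case: (fmeet p q).
  + move=> [[p|p]|] [[q|q]|] //= pq.
    * exact: (c4 (Some (inl p)) (Some (inl q))).
    * exact: r4.
    * exact: (c4 None (Some (inl q))).
    * exact: (c4 None None).
exists (fun p => Some (inr (er p))); split.
- by move=> p; rewrite -r1.
- move=> [[q|q]|] /=; last by left.
    by left; apply: H1; apply/labels_tab; exists q.
  case: (r2 q) => [|[p [ep pq]]]; first by left.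
  by right; exists p; split=> //; rewrite fle_node.
- by move=> p q; rewrite [LHS]/= r3; case: (fmeet p q).
- by move=> p q /r4.
Qed.

(** * The two orders on positions *)

Lemma fmeet_lb u (p q m : pos u) : fmeet p q = Some m -> fle m p /\ fle m q.
Proof.
elim: u p q m => [[]|l c IHc r IHr] [[p|p]|] [[q|q]|] //= m.
- case E: (fmeet p q) => [m'|] [<-] //.
  by have [/eqP H1 /eqP H2] := IHc _ _ _ E; rewrite /fle /= H1 H2.
- by case=> <-.
- case E: (fmeet p q) => [m'|] // [<-].
  by have [/eqP H1 /eqP H2] := IHr _ _ _ E; rewrite /fle /= H1 H2.
- by case=> <-.
- by case=> <-.
Qed.

Lemma fmeet_glb u (p q r : pos u) : fle r p -> fle r q ->
  exists2 m, fmeet p q = Some m & fle r m.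
Proof.
rewrite /fle; elim: u p q r => [[]|l c IHc d IHd] [[p|p]|] [[q|q]|] [[r|r]|] //=;
  rewrite ?eqxx //.
- case E: (fmeet r p) => [m|] // /eqP [e]; subst m.
  case E': (fmeet r q) => [m|] // /eqP [e]; subst m.
  have [|| m -> /eqP Em] := IHc p q r; rewrite ?E ?E' //.
  by exists (Some (inl m)); rewrite //= Em.
- by move=> _ _; eexists; first reflexivity; case: fmeet.
- by move=> _ _; exists None.
- case E: (fmeet r p) => [m|] // /eqP [e]; subst m.
  case E': (fmeet r q) => [m|] // /eqP [e]; subst m.
  have [|| m -> /eqP Em] := IHd p q r; rewrite ?E ?E' //.
  by exists (Some (inr m)); rewrite //= Em.
- by move=> _ _; exists None.
- by move=> _ _; exists None.
Qed.

Lemma fle_anti u (p q : pos u) : fle p q -> fle q p -> p = q.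
Proof.
rewrite /fle; elim: u p q => [[]|l c IHc d IHd] [[p|p]|] [[q|q]|] //=.
- case E: fmeet => [m|] // /eqP [e]; subst m.
  case E': fmeet => [m|] // /eqP [e]; subst m.
  by rewrite (IHc p q) ?E ?E'.
- case E: fmeet => [m|] // /eqP [e]; subst m.
  case E': fmeet => [m|] // /eqP [e]; subst m.
  by rewrite (IHd p q) ?E ?E'.
Qed.

Lemma fle_refl u (p : pos u) : fle p p.
Proof. by rewrite /fle fmeetxx. Qed.

Lemma fle_trans u (p q r : pos u) : fle p q -> fle q r -> fle p r.
Proof.
elim: u p q r => [[]|l c IHc d IHd] [[p|p]|] [[q|q]|] [[r|r]|] //;
  rewrite !fle_node //; [exact: IHc | exact: IHd].
Qed.

Lemma fle_lin u (p q r : pos u) : fle p r -> fle q r -> fle p q \/ fle q p.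
Proof.
elim: u p q r => [[]|l c IHc d IHd] [[p|p]|] [[q|q]|] [[r|r]|] //;
  rewrite !fle_node //; [exact: IHc | by right | exact: IHd | by left | by left | by left].
Qed.

Lemma ple_refl u (p : pos u) : ple p p.
Proof. by elim: u p => [[]|l c IHc r IHr] [[p|p]|] /=. Qed.

Lemma ple_anti u (p q : pos u) : ple p q -> ple q p -> p = q.
Proof.
elim: u p q => [[]|l c IHc r IHr] [[p|p]|] [[q|q]|] //= H1 H2.
  by rewrite (IHc p q).
by rewrite (IHr p q).
Qed.

Lemma ple_trans u (p q r : pos u) : ple p q -> ple q r -> ple p r.
Proof.
by elim: u p q r => [[]|l c IHc d IHd] [[p|p]|] [[q|q]|] [[r|r]|] //=;
  [exact: IHc | exact: IHd].
Qed.

Lemma ple_total u (p q : pos u) : ple p q \/ ple q p.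
Proof.
by elim: u p q => [[]|l c IHc r IHr] [[p|p]|] [[q|q]|] //=; auto.
Qed.

Lemma fle_ple u (p q : pos u) : fle p q -> ple p q.
Proof.
by elim: u p q => [[]|l c IHc r IHr] [[p|p]|] [[q|q]|] //; rewrite fle_node //=;
  [exact: IHc | exact: IHr].
Qed.

Lemma ple_above u (a b p q : pos u) : ~~ fle a b -> ple a b ->
  fle a p -> fle b q -> ple p q.
Proof.
elim: u a b p q => [[]|l c IHc r IHr] [[a|a]|] [[b|b]|] [[p|p]|] [[q|q]|] //;
  rewrite !fle_node //=; [exact: IHc | exact: IHr].
Qed.

(** * Coding an ordered tree by positions *)

Section OrderedTreeTheory.
Variable T : OrderedTree.
Implicit Types v w m a b x y : T.

Lemma meet_unique m m' v w : is_meet (tle (o:=T)) m v w ->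
  is_meet (tle (o:=T)) m' v w -> m = m'.
Proof.
by move=> [mv [mw mg]] [mv' [mw' mg']]; apply: tle_anti; [apply: mg' | apply: mg].
Qed.

Lemma imm_exists v w : tle v w -> v != w ->
  exists a, is_imm (tle (o:=T)) v a /\ tle a w.
Proof.
move=> vw nvw.
pose P a := [&& tle v a, v != a & tle a w].
have Pw : P w by rewrite /P vw nvw tle_refl.
case: (@arg_minnP _ w P (fun a => #|[pred z | tle z a]|) Pw) => a /and3P [va nva aw] amin.
exists a; split=> //; split=> //; split; first exact/eqP.
move=> z vz za; case: (eqVneq z v) => [|nzv]; first by left.
right; apply/eqP/negPn/negP => nza.
have /amin : P z.
  by rewrite /P vz eq_sym nzv (tle_trans za).
rewrite leqNgt => /negP; apply; apply: proper_card; apply/properP; split.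
  by apply/subsetP => y; rewrite !inE => /tle_trans; exact.
exists a; rewrite !inE ?tle_refl //; apply: contraNN nza => az.
by apply/eqP/tle_anti.
Qed.

Lemma imm_incomparable m a b : is_imm (tle (o:=T)) m a -> is_imm (tle (o:=T)) m b ->
  tle a b -> a = b.
Proof. by move=> [ma [nma _]] [_ [_ mb]] ab; case: (mb a ma ab) => // e; case: nma. Qed.

Lemma imm_unique m a b w : is_imm (tle (o:=T)) m a -> is_imm (tle (o:=T)) m b ->
  tle a w -> tle b w -> a = b.
Proof.
move=> ma mb aw bw; case: (tle_pred_lin aw bw) => H; first exact: imm_incomparable ma mb H.
by apply/esym; exact: imm_incomparable mb ma H.
Qed.

Section Branching.
Variables (m a b p q : T).
Hypotheses (ma : is_imm (tle (o:=T)) m a) (mb : is_imm (tle (o:=T)) m b).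
Hypotheses (nab : a <> b) (ap : tle a p) (bq : tle b q).

Lemma branch_incomparable : ~~ tle p q.
Proof.
by apply/negP => pq; apply: nab; apply: imm_unique ma mb (tle_trans ap pq) bq.
Qed.

Lemma branch_meet : is_meet (tle (o:=T)) m p q.
Proof.
have mp := tle_trans ma.1 ap; have mq := tle_trans mb.1 bq.
split=> //; split=> // z zp zq.
case: (tle_pred_lin zp ap) => [za | az]; last first.
  by case: nab; apply: imm_unique ma mb (tle_trans az zq) bq.
case: (tle_pred_lin zp mp) => // mz; case: ma => _ [_ /(_ z mz za)] [-> | zE].
  exact: tle_refl.
by case: nab; apply: imm_unique ma mb _ bq; rewrite -zE.
Qed.

End Branching.

Lemma lexle_branch m a b (p q : T) : is_imm (tle (o:=T)) m a -> is_imm (tle (o:=T)) m b ->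
  a <> b -> tle a p -> tle b q -> (lexle p q <-> sib a b).
Proof.
move=> ma mb nab ap bq.
have npq := branch_incomparable ma mb nab ap bq.
have nba : b <> a by move=> e; exact: nab.
have nqp := branch_incomparable mb ma nba bq ap.
have mpq := branch_meet ma mb nab ap bq.
split=> [[pq | [_ [_ [m' [a' [b' [H [ma' [mb' [ap' [bq' ss]]]]]]]]]]] | ss].
- by rewrite pq in npq.
- have em := meet_unique mpq H; subst m'.
  by rewrite (imm_unique ma ma' ap ap') (imm_unique mb mb' bq bq').
right; split; first exact/negP; split; first exact/negP.
by exists m, a, b.
Qed.

Lemma lexle_above x w : tle x w -> x <> w -> ~ lexle w x.
Proof.
move=> xw nxw [wx | [_ [] //]]; by apply: nxw; apply: tle_anti.
Qed.

(** Both directions of both orders are included, so that elements of different subtrees can be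
    compared without knowing [lexle] to be a linear order. *)
Definition before x y : Prop := forall p q : T, tle x p -> tle y q ->
  [/\ ~~ tle p q, ~~ tle q p, lexle p q & ~ lexle q p].

Fixpoint separated (l : seq T) : Prop :=
  if l is x :: l' then {in l', forall y, before x y} /\ separated l' else True.

Record forest_iso (u : forest unit) (S : T -> Prop) (beta : pos u -> T) : Prop := {
  iso_image : forall w, S w <-> exists p, beta p = w;
  iso_fle : forall p q, fle p q = tle (beta p) (beta q);
  iso_ple : forall p q, ple p q <-> lexle (beta p) (beta q) }.

Definition strictly_above x w : Prop := tle x w /\ x <> w.

Definition above_some (l : seq T) w : Prop := exists2 x, x \in l & tle x w.

Lemma forest_iso_seq l : separated l ->
  (forall x, x \in l -> exists u (beta : pos u -> T), forest_iso (strictly_above x) beta) ->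
  exists u (beta : pos u -> T), forest_iso (above_some l) beta.
Proof.
elim: l => [|x l IHl] /=.
  move=> _ _; exists Leaf, (fun p : void => match p with end); split=> [w|[]|[]] //.
  by split=> [[]|[[]]].
move=> [bx /IHl {}IHl] Hx.
have [u2 [b2 [im2 fle2 ple2]]] : exists u (beta : pos u -> T),
    forest_iso (above_some l) beta.
  by apply: IHl => y yl; apply: Hx; rewrite inE yl orbT.
have [u1 [b1 [im1 fle1 ple1]]] := Hx x (mem_head _ _).
pose beta (p : pos (Node tt u1 u2)) : T :=
  match p with None => x | Some (inl p') => b1 p' | Some (inr p') => b2 p' end.
have ab1 p : strictly_above x (b1 p) by apply/im1; exists p.
have sep p q : tle x p -> [/\ ~~ tle p (b2 q), ~~ tle (b2 q) p,
    lexle p (b2 q) & ~ lexle (b2 q) p].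
  move=> xp; have [y yl yq] : above_some l (b2 q) by apply/im2; exists q.
  exact: bx yl _ _ xp yq.
have xx := tle_refl x.
exists (Node tt u1 u2), beta; split.
- move=> w; split.
    case=> y; rewrite inE => /orP [/eqP -> xw | yl yw].
      have [e | /eqP nxw] := eqVneq x w; first by exists None.
      by have [p ep] := (im1 w).1 (conj xw nxw); exists (Some (inl p)).
    by have [p ep] := (im2 w).1 (ex_intro2 _ _ y yl yw); exists (Some (inr p)).
  case=> -[[p|p]|] <- /=.
  + by exists x; rewrite ?mem_head; case: (ab1 p).
  + have [y yl yq] : above_some l (b2 p) by apply/im2; exists p.
    by exists y; rewrite // inE yl orbT.
  + by exists x; rewrite ?mem_head.
- move=> [[p|p]|] [[q|q]|]; rewrite fle_node //=.
  + by case: (sep (b1 p) q (ab1 p).1) => /negbTE ->.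
  + case: (ab1 p) => xp nxp; apply/esym/negbTE/negP => px.
    by apply: nxp; apply: tle_anti.
  + by case: (sep (b1 q) p (ab1 q).1) => _ /negbTE ->.
  + by case: (sep x p xx) => _ /negbTE ->.
  + by case: (ab1 q) => ->.
  + by case: (sep x q xx) => /negbTE ->.
- move=> [[p|p]|] [[q|q]|] //=; split=> // H.
  + by case: (sep (b1 p) q (ab1 p).1).
  + by case: (ab1 p) => xp nxp; case: (lexle_above xp nxp).
  + by case: (sep (b1 q) p (ab1 q).1) => _ _ _ [].
  + by case: (sep x p xx) => _ _ _ [].
  + by left; case: (ab1 q).
  + by case: (sep x q xx).
  + by left.
Qed.

Definition immb v w := [&& tle v w, v != w &
  [forall u, tle v u ==> tle u w ==> (u == v) || (u == w)]].

Lemma immP v w : reflect (is_imm (tle (o:=T)) v w) (immb v w).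
Proof.
apply: (iffP and3P) => [[vw nvw /forallP H] | [vw [nvw H]]].
  split=> //; split; first exact/eqP.
  move=> u vu uw; have := H u; rewrite vu uw /=.
  by case/orP => /eqP ->; [left | right].
split=> //; first exact/eqP.
apply/forallP => u; apply/implyP => vu; apply/implyP => uw.
by case: (H u vu uw) => ->; rewrite eqxx ?orbT.
Qed.

Lemma sorted_children v : exists l : seq T,
  separated l /\ forall w, w \in l <-> is_imm (tle (o:=T)) v w.
Proof.
pose l0 := [seq w <- enum T | immb v w].
pose l := sort (sib (o:=T)) l0.
have memE w : w \in l = immb v w by rewrite mem_sort mem_filter mem_enum andbT.
have immE w : w \in l -> is_imm (tle (o:=T)) v w by rewrite memE => /immP.
have lP : all (mem l) l0 by apply/allP => w; rewrite /= mem_sort.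
(* [sib] is an order only among the successors of one node, hence the relativised sorting lemmas. *)
have srt : sorted (sib (o:=T)) l.
  apply: sort_sorted_in lP => x y /immE vx /immE vy.
  by case: (sib_total vx vy) => ->; rewrite ?orbT.
have unl : uniq l by rewrite sort_uniq filter_uniq // enum_uniq.
exists l; split; last by move=> w; rewrite memE; split=> /immP.
have {lP} : {in l, forall w, is_imm (tle (o:=T)) v w} by [].
elim: {l0 memE} l unl srt {immE} => //= x l IHl /andP [xl unl] xsrt immE.
have immE' : {in l, forall w, is_imm (tle (o:=T)) v w}.
  by move=> w wl; apply: immE; rewrite inE wl orbT.
split; last by apply: IHl => //; exact: path_sorted xsrt.
move=> y yl p q xp yq.
have vx : is_imm (tle (o:=T)) v x by apply: immE; rewrite mem_head.
have vy := immE' y yl.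
have nxy : x <> y by move=> e; rewrite e yl in xl.
have nyx : y <> x by move=> e; exact: nxy.
have sxy : sib x y.
  have tr : {in x :: l & &, transitive (sib (o:=T))}.
    by move=> b a c /immE vb /immE va /immE vc; exact: sib_trans va vb vc.
  have lP : all (mem (x :: l)) (x :: l) by apply/allP.
  by have /allP /(_ y yl) := order_path_min_in tr lP xsrt.
split.
- exact: branch_incomparable vx vy nxy xp yq.
- exact: branch_incomparable vy vx nyx yq xp.
- exact/(lexle_branch vx vy nxy xp yq).
- move/(lexle_branch vy vx nyx yq xp) => syx.
  by apply: nxy; exact: sib_anti vx vy sxy syx.
Qed.

Lemma forest_iso_above x : exists u (beta : pos u -> T),
  forest_iso (strictly_above x) beta.
Proof.
have [n] := ubnP #|[pred w | tle x w]|; elim: n x => // n IHn x xn.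
have [l [sl memE]] := sorted_children x.
have [|u [beta [im fleE pleE]]] := @forest_iso_seq l sl.
  move=> y /memE [xy [nxy _]]; apply: IHn; rewrite -ltnS (leq_trans _ xn) // ltnS.
  apply: proper_card; apply/properP; split.
    by apply/subsetP => z; rewrite !inE; exact: tle_trans.
  exists x; rewrite !inE ?tle_refl //; apply/negP => yx.
  by apply: nxy; apply: tle_anti.
exists u, beta; split=> // w; split.
  case=> xw /eqP nxw; apply/im; have [a [xa aw]] := imm_exists xw nxw.
  by exists a; first exact/memE.
case/im => a /memE [xa [nxa _]] aw; split; first exact: tle_trans aw.
by move=> e; apply: nxa; apply: tle_anti => //; rewrite e.
Qed.

Definition tree_iso (u : forest unit) (beta : pos (Node tt u Leaf) -> T) : Prop :=
  forest_iso (fun=> True) beta.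

Lemma tree_iso_exists : exists u (beta : pos (Node tt u Leaf) -> T), tree_iso beta.
Proof.
have [r rP] := tle_root T; have [u [b1 [im1 fle1 ple1]]] := forest_iso_above r.
have ab1 p : strictly_above r (b1 p) by apply/im1; exists p.
pose beta (p : pos (Node tt u Leaf)) : T :=
  match p with None => r | Some (inl p') => b1 p' | Some (inr p') => match p' with end end.
exists u, beta; split.
- move=> w; split=> // _; have [e | /eqP nrw] := eqVneq r w; first by exists None.
  by have [p ep] := (im1 w).1 (conj (rP w) nrw); exists (Some (inl p)).
- move=> [[p|[]]|] [[q|[]]|]; rewrite fle_node //=.
  + apply/esym/negbTE/negP => pr; case: (ab1 p) => rp; apply.
    exact: tle_anti.
  + by rewrite rP.
  + by rewrite tle_refl.
- move=> [[p|[]]|] [[q|[]]|] //=; split=> // H.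
  + by case: (ab1 p) => rp nrp; case: (lexle_above rp nrp).
  + by left.
  + by left; exact: tle_refl.
Qed.

End OrderedTreeTheory.

(** * The ordered tree of a shape *)

Lemma fle_root u (q : pos (Node tt u Leaf)) : fle (None : pos (Node tt u Leaf)) q.
Proof. by case: q => [[q|[]]|]. Qed.

Definition position_tree (u : forest unit) : OrderedTree.
Proof.
refine (@Build_OrderedTree (pos (Node tt u Leaf)) (@fle (Node tt u Leaf))
  (@ple (Node tt u Leaf)) _ _ _ _ _ _ _ _ _).
- exact: fle_refl.
- exact: fle_anti.
- exact: fle_trans.
- by exists None => v; exact: fle_root.
- exact: fle_lin.
- by move=> _ x _; exact: ple_refl.
- by move=> _ x y _ _; exact: ple_anti.
- by move=> _ x y z _ _ _; exact: ple_trans.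
- by move=> _ x y _ _; exact: ple_total.
Defined.

Lemma fmeet_total u (p q : pos (Node tt u Leaf)) : exists m, fmeet p q = Some m.
Proof. by have [m -> _] := fmeet_glb (fle_root p) (fle_root q); exists m. Qed.

Lemma is_meet_fmeet u (m p q : pos (Node tt u Leaf)) :
  is_meet (@fle (Node tt u Leaf)) m p q <-> fmeet p q = Some m.
Proof.
split=> [[mp [mq mg]] | e].
  have [m' e mm'] := fmeet_glb mp mq; have [m'p m'q] := fmeet_lb e.
  by rewrite e (fle_anti mm' (mg _ m'p m'q)).
have [mp mq] := fmeet_lb e; split=> //; split=> // z zp zq.
by have [m' ] := fmeet_glb zp zq; rewrite e => -[<-].
Qed.

(** For incomparable positions [lexle] is decided at the immediate successors of their meet, and
    [ple] passes from these to everything above them. *)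
Lemma position_tree_iso u : @tree_iso (position_tree u) u id.
Proof.
split=> //; first by move=> w; split=> // _; exists w.
move=> p q.
case pq : (@fle (Node tt u Leaf) p q); first by split=> _; [left | exact: fle_ple].
case qp : (@fle (Node tt u Leaf) q p).
  split=> [H | [|[_ []]] //]; last by rewrite /= pq.
  by move: pq; rewrite (ple_anti H (fle_ple qp)) fle_refl.
have [m mpq] := fmeet_total p q; have [mp mq] := fmeet_lb mpq.
have [a [ma ap]] : exists a, is_imm (tle (o:=position_tree u)) m a /\ tle a p.
  by apply: imm_exists => //; apply: contraFneq pq => <-.
have [b [mb bq]] : exists b, is_imm (tle (o:=position_tree u)) m b /\ tle b q.
  by apply: imm_exists => //; apply: contraFneq qp => <-.
have nab : a <> b.
  move=> e; subst b; have [m' ] := @fmeet_glb (Node tt u Leaf) p q a ap bq.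
  rewrite mpq => -[<-] am; case: ma => ma [nma _]; apply: nma.
  exact: (@fle_anti (Node tt u Leaf)).
have nba : b <> a by move=> e; exact: nab.
have nfab : ~~ tle a b by exact: branch_incomparable ma mb nab (tle_refl a) (tle_refl b).
have nfba : ~~ tle b a by exact: branch_incomparable mb ma nba (tle_refl b) (tle_refl a).
apply: iff_sym; apply: iff_trans (lexle_branch ma mb nab ap bq) _.
split=> [sab | H]; first exact: ple_above nfab sab ap bq.
case: (@ple_total (Node tt u Leaf) a b) => // sba.
have H' := ple_above nfba sba bq ap.
by move: pq; rewrite (ple_anti H H') fle_refl.
Qed.

Section TreeIso.
Variables (T : OrderedTree) (u : forest unit) (beta : pos (Node tt u Leaf) -> T).
Hypothesis iso : tree_iso beta.

Lemma tree_iso_inj : injective beta.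
Proof.
by move=> p q e; apply: fle_anti; rewrite (iso_fle iso) e tle_refl.
Qed.

Lemma tree_iso_inv : exists gamma, cancel gamma beta /\ cancel beta gamma.
Proof.
have ex (w : T) : exists p, beta p = w by apply/(iso_image iso).
have [gamma gE] := fin_all_exists ex.
by exists gamma; split=> // p; apply: tree_iso_inj.
Qed.

Lemma tree_iso_root : is_root (tle (o:=T)) (beta None).
Proof.
move=> v; have [p <-] := (iso_image iso v).1 I.
by rewrite -(iso_fle iso) fle_root.
Qed.

Lemma tree_iso_meet m p q :
  is_meet (tle (o:=T)) (beta m) (beta p) (beta q) <-> fmeet p q = Some m.
Proof.
rewrite -is_meet_fmeet /is_meet !(iso_fle iso); split=> [[mp [mq mg]]|[mp [mq mg]]];
  split=> //; split=> // z.
  by rewrite !(iso_fle iso); exact: mg.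
have [p' <-] := (iso_image iso z).1 I.
by rewrite -!(iso_fle iso); exact: mg.
Qed.

End TreeIso.

Lemma root_unique (T : OrderedTree) (r r' : T) :
  is_root (tle (o:=T)) r -> is_root (tle (o:=T)) r' -> r = r'.
Proof. by move=> rP rP'; apply: tle_anti. Qed.

(** * Rigid surjections of ordered trees in terms of positions *)

Section RigidSurjections.
Variables (T S : OrderedTree) (u s : forest unit).
Variables (betaT : pos (Node tt u Leaf) -> T) (betaS : pos (Node tt s Leaf) -> S).
Hypotheses (isoT : tree_iso betaT) (isoS : tree_iso betaS).
Variables (N : S -> nat) (f : {ffun T -> S}).
Hypothesis NI : injective N.

Lemma rigid_surj_rigid : rigid_surj f ->
  exists e, rigid [::] (fun p => N (betaS p)) (fun q => N (f (betaT q))) e.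
Proof.
case=> e [[e_meet [e_lex _]] [fe ef]].
have [gT [gTK _]] := tree_iso_inv isoT; have [gS [gSK _]] := tree_iso_inv isoS.
exists (fun p => gT (e (betaS p))); split.
- by move=> p; rewrite gTK fe.
- move=> q; right; exists (gS (f (betaT q))); rewrite gSK; split=> //.
  by rewrite (iso_fle isoT) gTK.
- move=> p q; have [m mpq] := fmeet_total p q; rewrite mpq /=.
  apply/(tree_iso_meet isoT); rewrite !gTK; apply: e_meet.
  exact/(tree_iso_meet isoS).
- move=> p q /(iso_ple isoS) /e_lex H; apply/(iso_ple isoT).
  by rewrite !gTK.
Qed.

Lemma rigid_rigid_surj e :
  rigid [::] (fun p => N (betaS p)) (fun q => N (f (betaT q))) e -> rigid_surj f.
Proof.
case=> e1 e2 e3 e4.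
have [gT [gTK _]] := tree_iso_inv isoT; have [gS [gSK bSK]] := tree_iso_inv isoS.
exists (fun v => betaT (e (gS v))); split; last first.
  split=> [v | w]; first by apply: NI; rewrite e1 gSK.
  case: (e2 (gT w)) => // -[p [Np pw]]; rewrite gTK in Np.
  by rewrite (NI Np) bSK -[X in tle _ X]gTK -(iso_fle isoT).
split; last split.
- move=> v w m.
  rewrite -[in X in X -> _](gSK v) -[in X in X -> _](gSK w) -[in X in X -> _](gSK m).
  move/(tree_iso_meet isoS) => H; apply/(tree_iso_meet isoT).
  by rewrite e3 H.
- move=> v w; rewrite -{1}(gSK v) -{1}(gSK w) => /(iso_ple isoS) /e4.
  by move/(iso_ple isoT).
move=> r rP; have -> : r = betaS None by exact: root_unique rP (tree_iso_root isoS).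
(* The root position lies above some [e p], hence equals it; since [e] preserves meets, [e None]
   lies below [e p] and is the root as well. *)
rewrite bSK; suff -> : e None = None by exact: tree_iso_root.
case: (e2 None) => // -[p [_ pN]].
have ep : e p = None by apply: fle_anti pN _; exact: fle_root.
case: p ep {pN} => [[p|[]]|] // ep; have := e3 None (Some (inl p)).
by rewrite ep /=; case: (e None) => [[q|[]]|].
Qed.

End RigidSurjections.

Lemma admissible_tab (A : seq nat) u (nu : pos u -> nat) : injective nu ->
  (forall p, nu p \notin A) -> admissible A (tab nu).
Proof.
elim: u A nu => //= _ c IHc r IHr A nu nuI nuA; rewrite nuA IHc ?IHr //.
- by move=> p q /nuI [].
- by move=> p q /nuI [].
- by move=> p; rewrite inE negb_or nuA andbT; apply/eqP => /nuI.
Qed.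

Lemma lookup_fmap u w (f : nat -> nat) (p : pos u) : skel w = u ->
  lookup (fmap f w) p = f (lookup w p).
Proof.
by move=> Sw; subst u; elim: w p => [[]|a c IHc r IHr] [[p|p]|] /=.
Qed.

Lemma lookup_labels u w (p : pos u) : skel w = u -> lookup w p \in labels w.
Proof. by move=> /tab_lookup {2}<-; apply/labels_tab; exists p. Qed.

Section Names.
Variables (T : OrderedTree) (r : T).

(** The root is named [0], the one constant letter of the words describing the forest above it. *)
Definition name (v : T) : nat := if v == r then 0 else (enum_rank v).+1.

Definition node (i : nat) : T := odflt r [pick v | name v == i].

Lemma name_inj : injective name.
Proof.
move=> v w; rewrite /name; case: eqP => [->|_]; case: eqP => [->|_] //.
by case=> /val_inj /enum_rank_inj.
Qed.

Lemma nameK : cancel name node.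
Proof.
move=> v; rewrite /node; case: pickP => [w /eqP /name_inj // | /(_ v)].
by rewrite eqxx.
Qed.

Lemma name_root : name r = 0.
Proof. by rewrite /name eqxx. Qed.

End Names.

Theorem theorem2p4 (b : nat) (S T : OrderedTree) :
  0 < b ->
  exists U : OrderedTree,
    forall c : {ffun U -> S} -> 'I_b,
      exists g0 : {ffun U -> T},
        rigid_surj g0 /\
        exists i : 'I_b, forall f : {ffun T -> S},
          rigid_surj f -> c [ffun u => f (g0 u)] = i.
Proof.
move=> b0.
have [s [betaS isoS]] := tree_iso_exists S.
have [t [betaT isoT]] := tree_iso_exists T.
pose rS := betaS None; pose rT := betaT None.
pose nameS := name rS; pose nameT := name rT.
have nameS_I : injective nameS := @name_inj S rS.
have nameT_I : injective nameT := @name_inj T rT.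
pose sw : word := tab (fun p => nameS (betaS (Some (inl p)))).
pose tw : word := tab (fun p => nameT (betaT (Some (inl p)))).
have adm : admissible [:: 0] sw.
  apply: admissible_tab => [p q /nameS_I /(tree_iso_inj isoS) [] // | p].
  rewrite inE -(name_root rS); apply/eqP => /nameS_I.
  by move/(tree_iso_inj isoS).
have [u Hu] := ramsey_forest (mem_head 0 [::]) adm tw 'I_b.
exists (position_tree u) => c.
pose letter w (p : pos (Node tt u Leaf)) : nat :=
  if p is Some (inl q) then lookup w q else 0.
have [g [Sg Hg cg]] :=
  Hu (fun w => c [ffun p : position_tree u => node rS (letter w p)]).
pose g0 : {ffun position_tree u -> T} := [ffun p => node rT (letter g p)].
have name_g0 p : nameT (g0 p) = letter g p.
  rewrite ffunE; case: p => [[q|[]]|]; last by rewrite /= -(name_root rT) nameK.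
  have /= := Hom_labels Hg (lookup_labels q Sg).
  rewrite inE => /orP [/eqP -> | /labels_tab [p <-]].
    by rewrite -(name_root rT) nameK.
  by rewrite nameK.
have g0_rigid : rigid_surj g0.
  have : Hom [::] (tab (fun p => nameT (betaT p)))
      (tab (fun q : pos (Node tt u Leaf) => nameT (g0 q))).
    (* With both roots labelled [0], the first clause of [Hom] turns a word with constant [0] into a
       word for the whole tree without constants. *)
    rewrite (eq_tab (h' := letter g)) //=; apply: Or31.
    by rewrite /nameT name_root (tab_lookup Sg).
  case/Hom_rigid => e.
  exact: (@rigid_rigid_surj (position_tree u) T u t id betaT (position_tree_iso u)
    isoT nameT g0 nameT_I e).
exists g0; split=> //.
have key f : rigid_surj f -> exists h, [/\ {in [:: 0], h =1 id},
    Hom [:: 0] sw (fmap h tw) &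
    [ffun p : position_tree u => node rS (letter (fmap h g) p)] =
    [ffun p => f (g0 p)] :> {ffun position_tree u -> S}].
  move=> fr; have [e] := rigid_surj_rigid isoT isoS nameS fr.
  have nuI : injective (fun p => nameS (betaS p)).
    by move=> p q /nameS_I /(tree_iso_inj isoS).
  move/(rigid_Hom nuI) => /= [[froot Hf _] | [] // | [] //].
  pose h i := nameS (f (node rT i)); exists h.
  have h0 : h 0 = 0.
    by rewrite /h -{1}(name_root rT) nameK froot /nameS name_root.
  split.
  - by move=> i; rewrite inE => /eqP ->.
  - rewrite /tw fmap_tab; move: Hf; rewrite /nameS name_root.
    by congr Hom; apply: eq_tab => p; rewrite /h /= nameK.
  apply/ffunP => p; rewrite !ffunE; case: p => [[q|[]]|] /=.
    by rewrite lookup_fmap // nameK.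
  by rewrite -{1}h0 nameK.
(* If there is no rigid surjection from [T] to [S], any colour will do, and [0 < b] provides one. *)
have [[f fr] | nof] := classic (exists f : {ffun T -> S}, rigid_surj f); last first.
  by exists (Ordinal b0) => f fr; case: nof; exists f.
exists (c [ffun p => f (g0 p)]) => f' fr'.
have [h [h0 Hh <-]] := key f fr; have [h' [h0' Hh' <-]] := key f' fr'.
exact: cg.
Qed.
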